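(* Let $\mathcal{M}$ be a constraint hypersurface with degenerate induced form $g^{\mathcal{M}}$, null distribution $\mathcal{N}$, complement $\mathcal{S}$ and constraint-preserving vector field $\mathcal{V}$ as described in the context, where $\mathcal{N}$ is involutive, the leaves of the null foliation $\mathscr{F}$ are embedded and compact, the leaf space $\mathcal{M}_{\mathrm{red}}=\mathcal{M}/\mathscr{F}$ is Hausdorff, and $\mathcal{V}$ preserves $\mathscr{F}$ in the sense that $[\mathcal{V},W]\in\Gamma(\mathcal{N})$ for every $W\in\Gamma(\mathcal{N})$, equivalently $\varphi_t(\mathcal{L})=\mathcal{L}$ for every leaf $\mathcal{L}$ of $\mathscr{F}$ and all $t\ge 0$, where $\varphi_t$ is the flow generated by $\mathcal{V}$. Let $\Psi:\mathcal{M}\to\mathbb{R}$ be a $C^1$ functional, bounded from below, with $d\Psi(Y)=0$ for all $Y\in\mathcal{N}$ and $d\Psi(\mathcal{V}_{\mathcal{S}})\le -c\|\mathcal{V}_{\mathcal{S}}\|_{\mathcal{S}}^2$ on $\mathcal{M}$ for some constant $c>0$. Suppose that the intrinsic evolution generated by $\mathcal{V}$ defines a continuous semiflow on $\mathcal{M}$ which is asymptotically compact and admits a bounded absorbing set. Then there exists a unique compact invariant set $\mathcal{A}\subset\mathcal{M}$ (the global attractor) such that for every bounded initial condition $X_0\in\mathcal{M}$, $\lim_{t\to\infty}\operatorname{dist}(X(t;X_0),\mathcal{A})=0$. Moreover $\mathcal{A}$ is saturated with respect to $\mathscr{F}$: if $X\in\mathcal{A}$, then the leaf $\mathcal{L}_X$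 of $\mathscr{F}$ through $X$ satisfies $\mathcal{L}_X\subset\mathcal{A}$.
   Context: Geometric setting. $\mathcal{U}$ is a smooth $n$-dimensional manifold with a smooth symmetric $(0,2)$-tensor field $g$ of Lorentzian signature $(-,+,\dots,+)$; $\Phi:\mathcal{U}\to\mathbb{R}$ is smooth with $d\Phi\neq 0$ on $\Phi^{-1}(0)$; $\mathcal{M}=\Phi^{-1}(0)$. The restriction $g^{\mathcal{M}}=g|_{T\mathcal{M}\times T\mathcal{M}}$ has constant corank $k\ge 1$; the null distribution is the rank-$k$ subbundle $\mathcal{N}=\ker g^{\mathcal{M}}\subset T\mathcal{M}$, and $\mathcal{S}\subset T\mathcal{M}$ is a smooth complementary subbundle, $T\mathcal{M}=\mathcal{N}\oplus\mathcal{S}$, on which $g^{\mathcal{M}}$ is nondegenerate; $\|\cdot\|_{\mathcal{S}}$ is a smooth norm on $\mathcal{S}$ induced by $g^{\mathcal{M}}|_{\mathcal{S}}$. $\mathcal{V}$ is a $C^2$ vector field on $\mathcal{U}$ with $d\Phi(\mathcal{V})=0$ on $\mathcal{M}$, regarded as a vector field on $\mathcal{M}$; the intrinsic evolution is $\dot X=\mathcal{V}(X)$ on $\mathcal{M}$, $X(t;X_0)$ denotes its solution with initial condition $X_0$, and $\mathcal{V}=\mathcal{V}_{\mathcal{N}}+\mathcal{V}_{\mathcal{S}}$ is the decomposition with respect to the splitting. Foliation. When $\mathcal{N}$ is involutive, $\mathscr{F}$ denotes the foliation of $\mathcal{M}$ by the integral manifolds of $\mathcal{N}$, called leaves. Dynamics.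 $\operatorname{dist}$ and ''bounded'' refer to a distance on $\mathcal{M}$. The evolution is asymptotically compact if for every bounded sequence $\{X_k\}\subset\mathcal{M}$ and every $t_k\to\infty$ the sequence $X(t_k;X_k)$ has a convergent subsequence in $\mathcal{M}$. A bounded absorbing set is a bounded $\mathcal{B}\subset\mathcal{M}$ such that for every bounded $D\subset\mathcal{M}$ there is $T_D\ge 0$ with $\varphi_t(D)\subset\mathcal{B}$ for all $t\ge T_D$.
   Formalization: Uniqueness is claimed among compact invariant sets attracting every bounded set of initial conditions uniformly, since with attraction of single points it fails (a gradient flow on a compact M: M and its equilibrium set both qualify); the pointwise limit is also proved. *)

(* Defs.v *)
From HB Require Import structures.
From mathcomp Require Import all_boot all_order all_algebra.
From mathcomp Require Import all_classical all_reals all_analysis.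

Set Implicit Arguments.
Unset Strict Implicit.
Unset Printing Implicit Defensive.

Import Order.TTheory GRing.Theory Num.Theory.
Import numFieldNormedType.Exports.

Local Open Scope classical_set_scope.
Local Open Scope ring_scope.

Fixpoint Ck (R : realType) (n : nat) (W : normedModType R) (r : nat)
    (D : set 'rV[R]_n) (f : 'rV[R]_n -> W) : Prop :=
  match r with
  | 0 => forall x, D x -> {for x, continuous f}
  | r'.+1 => (forall x, D x -> differentiable f x) /\
             (forall v, Ck r' D (fun x => 'D_v f x))
  end.

(* [Some r] stands for class C^r and [None] for class C^oo. *)
Definition Cr (R : realType) (n : nat) (W : normedModType R) (r : option nat)
    (D : set 'rV[R]_n) (f : 'rV[R]_n -> W) : Prop :=
  if r is Some k then Ck k D f else forall k, Ck k D f.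

(* [mpsi i] is the inverse of the chart [mphi i : mdom i -> R^n]; the values
   of both maps outside their domains are irrelevant. *)
Record smooth_manifold (R : realType) (n : nat) := SmoothManifold {
  carrier :> topologicalType ;
  mchart : Type ;
  mdom : mchart -> set carrier ;
  mphi : mchart -> carrier -> 'rV[R]_n ;
  mpsi : mchart -> 'rV[R]_n -> carrier ;
  chart_at : carrier -> mchart ;
  mf_hausdorff : hausdorff_space carrier ;
  mf_second_countable : @second_countable carrier ;
  mdom_open : forall i, open (mdom i) ;
  mdom_cover : forall p, mdom (chart_at p) p ;
  mimg_open : forall i, open (mphi i @` mdom i) ;
  mphiK : forall i p, mdom i p -> mpsi i (mphi i p) = p ;
  mphi_continuous : forall i p, mdom i p -> {for p, continuous (mphi i)} ;
  mpsi_continuous : forall i x, (mphi i @` mdom i) x ->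
    {for x, continuous (mpsi i)} ;
  mtransition : forall i j,
    Cr None (mphi i @` (mdom i `&` mdom j)) (mphi j \o mpsi i)
}.

Section Manifold.
Context {R : realType} {n : nat} (U : smooth_manifold R n).

(* A tangent vector is encoded by the family of its components in all the
   charts, put equal to 0 in the charts that do not contain the base point. *)
Definition tvec := mchart U -> 'rV[R]_n.

(* The velocity at [y], in direction [w], of a parametrization s : R^m -> U. *)
Definition dparam (m : nat) (s : 'rV[R]_m -> U) (y w : 'rV[R]_m) : tvec :=
  fun i => if `[< mdom i (s y) >] then 'D_w (mphi i \o s) y else 0.

(* For s = [mpsi i] this is both the transformation law of the components and
   the vanishing convention. *)
Definition tangent (p : U) : set tvec :=
  [set v | forall i, mdom i p -> v = dparam (@mpsi _ _ U i) (mphi i p) (v i)].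

Definition coord_vec (i : mchart U) (a : 'I_n) (p : U) : tvec :=
  dparam (@mpsi _ _ U i) (mphi i p) (delta_mx 0 a).

Definition local_ext (W : normedModType R) (r : option nat) (A : set U)
    (f : U -> W) (i : mchart U) (p : U) (h : 'rV[R]_n -> W) : Prop :=
  exists D : set 'rV[R]_n, [/\ open D, D (mphi i p), Cr r D h &
    forall q, A q -> mdom i q -> D (mphi i q) -> f q = h (mphi i q)].

(* A map on a subset (e.g. a submanifold) is C^r when it extends locally to a
   C^r map of the ambient manifold. *)
Definition C_on (W : normedModType R) (r : option nat) (A : set U)
    (f : U -> W) : Prop :=
  forall p i, A p -> mdom i p -> exists h, local_ext r A f i p h.

(* Differential at p of a C^1 map f on a submanifold A, applied to a vector v
   tangent to A at p: the derivative along v of any local C^1 extension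
   (independent of the extension and of the chart when v is tangent to A). *)
Definition diff_on (W : normedModType R) (A : set U) (f : U -> W) (p : U)
    (v : tvec) : W :=
  let i := chart_at p in
  xget 0 [set 'D_(v i) h (mphi i p) | h in local_ext (Some 1%N) A f i p].

Definition vfield_on (r : option nat) (A : set U) (W : U -> tvec) : Prop :=
  (forall p, A p -> tangent p (W p)) /\
  (forall i, C_on r (A `&` mdom i) (fun p => W p i)).

Definition basis_of (r : nat) (E : set tvec) (b : 'I_r -> tvec) : Prop :=
  E = range (fun c : 'I_r -> R => \sum_(a < r) c a *: b a) /\
  forall c : 'I_r -> R, \sum_(a < r) c a *: b a = 0 -> forall a, c a = 0.

Definition has_dim (E : set tvec) (r : nat) : Prop :=
  exists b : 'I_r -> tvec, basis_of E b.

Definition smooth_subbundle (A : set U) (E : U -> set tvec) : Prop :=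
  forall p, A p -> exists G : set U, exists r : nat,
    exists b : 'I_r -> U -> tvec,
    [/\ open G, G p, forall a, vfield_on None (A `&` G) (b a) &
      forall q, A q -> G q -> basis_of (E q) (fun a => b a q)].

(* The space Gamma(E) of smooth global sections over A. *)
Definition section_of (A : set U) (E : U -> set tvec) (W : U -> tvec) : Prop :=
  vfield_on None A W /\ forall p, A p -> E p (W p).

(* Lie bracket of two C^1 vector fields tangent to a submanifold A, in
   components: [X,Y]^i = X(Y^i) - Y(X^i). *)
Definition lie_bracket (A : set U) (X Y : U -> tvec) (p : U) : tvec :=
  fun i => if `[< mdom i p >]
    then diff_on A (fun q => Y q i) p (X p) - diff_on A (fun q => X q i) p (Y p)
    else 0.

Definition involutive_dist (A : set U) (E : U -> set tvec) : Prop :=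
  forall W1 W2, section_of A E W1 -> section_of A E W2 ->
  forall p, A p -> E p (lie_bracket A W1 W2 p).

Definition lorentzian_metric (g : U -> tvec -> tvec -> R) : Prop :=
  [/\ forall p u v w (a : R), tangent p u -> tangent p v -> tangent p w ->
        g p (a *: u + v) w = a * g p u w + g p v w,
      forall p u v, tangent p u -> tangent p v -> g p u v = g p v u,
      forall i a b, C_on None (mdom i)
        (fun p => g p (coord_vec i a p) (coord_vec i b p) : R^o) &
      forall p, exists e : 'I_n -> tvec, basis_of (tangent p) e /\
        forall a b, g p (e a) (e b) =
          if a == b then (if nat_of_ord a == 0%N then -1 else 1) else 0].

Definition zero_set (Phi : U -> R) : set U := [set p | Phi p = 0].

(* The hypersurface M = Phi^-1(0) has T_pM = ker dPhi_p. *)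
Definition htangent (Phi : U -> R) (p : U) : set tvec :=
  [set v | tangent p v /\ diff_on setT (Phi : U -> R^o) p v = 0].

Definition null_dist (g : U -> tvec -> tvec -> R) (Phi : U -> R) (p : U) :
    set tvec :=
  [set v | htangent Phi p v /\ forall w, htangent Phi p w -> g p v w = 0].

(* T_pM = N_p (+) S_p with g nondegenerate on S_p. *)
Definition screen_at (g : U -> tvec -> tvec -> R) (Phi : U -> R)
    (S : U -> set tvec) (p : U) : Prop :=
  [/\ S p `<=` htangent Phi p,
      forall v, htangent Phi p v ->
        exists u w, [/\ null_dist g Phi p u, S p w & v = u + w],
      null_dist g Phi p `&` S p = [set 0] &
      forall v, S p v -> (forall w, S p w -> g p v w = 0) -> v = 0].

(* g is positive definite on a complement of the radical of a degenerate
   hyperplane of a Lorentzian space, so this is a norm there. *)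
Definition norm_of (g : U -> tvec -> tvec -> R) (p : U) (v : tvec) : R :=
  Num.sqrt (g p v v).

(* (O, psi, s): a smooth chart psi : O -> R^m of the m-dimensional embedded
   submanifold M, with inverse parametrization s. *)
Definition submfd_chart (m : nat) (M O : set U) (psi : U -> 'rV[R]_m)
    (s : 'rV[R]_m -> U) : Prop :=
  [/\ exists2 G : set U, open G & O = M `&` G,
      open (psi @` O),
      forall p, O p -> s (psi p) = p,
      C_on None O psi &
      (forall y, (psi @` O) y -> {for y, continuous s}) /\
      forall i, Cr None (psi @` O `&` s @^-1` mdom i) (mphi i \o s)].

(* The slice {q in O | psi_j(q) = c_j for all j >= k}. *)
Definition slice (m k : nat) (O : set U) (psi : U -> 'rV[R]_m) (c : 'rV[R]_m) :
    set U :=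
  [set q | O q /\ forall j : 'I_m, (k <= j)%N -> psi q 0 j = c 0 j].

(* Flat charts: psi(O) is an open cube, N is spanned by the first k coordinate
   directions, and each leaf meets O in a countable union of slices. *)
Definition flat_chart (m k : nat) (M : set U) (N : U -> set tvec)
    (F : set (set U)) (O : set U) (psi : U -> 'rV[R]_m)
    (s : 'rV[R]_m -> U) : Prop :=
  [/\ submfd_chart M O psi s,
      exists a b : 'rV[R]_m,
        psi @` O = [set y | forall j, a 0 j < y 0 j < b 0 j],
      forall p, O p -> N p = dparam s (psi p) @`
        [set w : 'rV[R]_m | forall j : 'I_m, (k <= j)%N -> w 0 j = 0] &
      forall L, F L -> exists2 K : set 'rV[R]_m, countable K &
        L `&` O = \bigcup_(c in K) slice k O psi c].

(* F is the set of leaves of the foliation of M by the integral manifolds of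
   N.  [connected] refers to the topology induced by U; it coincides with the
   leaf topology for embedded leaves. *)
Definition foliation_of (m k : nat) (M : set U) (N : U -> set tvec)
    (F : set (set U)) : Prop :=
  [/\ partition F id M,
      forall L, F L -> connected L &
      forall p, M p -> exists (O : set U) (psi : U -> 'rV[R]_m)
        (s : 'rV[R]_m -> U), O p /\ flat_chart k M N F O psi s].

(* Local slice criterion: L is a k-dimensional embedded submanifold of M. *)
Definition embedded_submfd (m k : nat) (M L : set U) : Prop :=
  forall p, L p -> exists (O : set U) (psi : U -> 'rV[R]_m)
    (s : 'rV[R]_m -> U),
    [/\ submfd_chart M O psi s, O p & L `&` O = slice k O psi (psi p)].

(* The leaf space M/F is the set F of leaves with the quotient topology: a set
   of leaves is open when its union is open in M. *)
Definition leaf_open (M : set U) (F P : set (set U)) : Prop :=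
  P `<=` F /\ exists2 G : set U, open G & \bigcup_(L in P) L = M `&` G.

Definition leaf_space_hausdorff (M : set U) (F : set (set U)) : Prop :=
  forall L1 L2, F L1 -> F L2 -> L1 <> L2 ->
  exists P1 P2 : set (set U),
    [/\ leaf_open M F P1, leaf_open M F P2, P1 L1, P2 L2 & P1 `&` P2 = set0].

Definition saturated (F : set (set U)) (A : set U) : Prop :=
  forall p L, A p -> F L -> L p -> L `<=` A.

End Manifold.

Section Dynamics.
Context {R : realType} {T : topologicalType}.
Implicit Types (M A D : set T) (d : T -> T -> R) (X : R -> T -> T).

(* d is a distance on M inducing the subspace topology. *)
Definition distance_on M d : Prop :=
  [/\ forall p q, M p -> M q -> d p q = 0 <-> p = q,
      forall p q, M p -> M q -> d p q = d q p,
      forall p q r, M p -> M q -> M r -> d p r <= d p q + d q r &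
      forall p, M p -> forall A, within M (nbhs p) A <->
        exists2 e : R, 0 < e & forall q, M q -> d p q < e -> A q].

Definition bounded_in d D : Prop :=
  exists C : R, forall p q, D p -> D q -> d p q <= C.

(* Extended-real valued, so that the distance to the empty set is +oo. *)
Definition dist_to d (p : T) A : \bar R := ereal_inf [set (d p q)%:E | q in A].

Definition continuous_semiflow M X : Prop :=
  [/\ forall t x, 0 <= t -> M x -> M (X t x),
      forall x, M x -> X 0 x = x,
      forall s t x, 0 <= s -> 0 <= t -> M x -> X (s + t) x = X s (X t x) &
      {within [set tx : R * T | 0 <= tx.1 /\ M tx.2],
        continuous (fun tx : R * T => X tx.1 tx.2)}].

Definition asymptotically_compact M d X : Prop :=
  forall (x : nat -> T) (t : nat -> R),
    range x `<=` M -> bounded_in d (range x) ->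
    (forall k, 0 <= t k) -> t @ \oo --> +oo ->
  exists (f : nat -> nat) (p : T),
    [/\ forall j k, (j < k)%N -> (f j < f k)%N, M p &
      (fun j => X (t (f j)) (x (f j))) @ \oo --> p].

Definition bounded_absorbing M d X (B : set T) : Prop :=
  [/\ B `<=` M, bounded_in d B &
    forall D, D `<=` M -> bounded_in d D -> exists2 TD : R, 0 <= TD &
      forall t, TD <= t -> X t @` D `<=` B].

(* The attraction is uniform over bounded sets of initial conditions. *)
Definition global_attractor M d X A : Prop :=
  [/\ A `<=` M, compact A,
      forall t, 0 <= t -> X t @` A = A &
      forall D, D `<=` M -> bounded_in d D -> forall e : R, 0 < e ->
        \forall t \near +oo, forall x, D x -> (dist_to d (X t x) A < e%:E)%E].

End Dynamics.

(* t |-> X t x solves X' = V(X) on [0, +oo[ (one-sided derivative at t = 0). *)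
Definition solution_family {R : realType} {n : nat} {U : smooth_manifold R n}
    (M : set U) (V : U -> tvec U) (X : R -> U -> U) : Prop :=
  forall x t, M x -> 0 <= t -> forall i, mdom i (X t x) ->
    h^-1 *: (mphi i (X (t + h) x) - mphi i (X t x))
      @[h --> within [set h : R | 0 <= t + h] (0 : R)^'] --> V (X t x) i.

(* Main.v *)
(** The attractor is the omega-limit set [A] of the absorbing set; the point is
    that it is saturated. In a flat chart, the bracket of [V] with [b d_a], where
    [b] is a bump function and [d_a] is tangent to the leaves, shows that the
    transverse components of [V] are constant along the plaques. By a Lipschitz
    comparison, in both time directions, two flow lines in the chart lie at time
    [t] on a common plaque exactly when they do at time [0]; and for small [t] the
    flow is a perturbation of the identity, hence locally onto. So [X t] maps the
    plaque of [x] onto a neighbourhood of [X t x] in its plaque, and since leaves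
    are compact and connected the leaf of [X t x] is contained in the image of the
    leaf of [x]. Hausdorffness of the leaf space makes compact leaves stable, so
    the admissible times [t] are uniform over the leaves meeting the compact set
    [A], and the union [E] of these leaves is bounded. As [X t @` A = A], this
    gives [E `<=` X t @` E] for arbitrarily large [t], and since [A] attracts the
    bounded set [E] it follows that [E `<=` A]. *)

From HB Require Import structures.
Require Import Defs.
From mathcomp Require Import all_boot all_order all_algebra.
From mathcomp Require Import all_classical all_reals all_analysis.
From mathcomp Require Import ring lra.

Set Implicit Arguments.
Unset Strict Implicit.
Unset Printing Implicit Defensive.

Import Order.TTheory GRing.Theory Num.Theory.
Import numFieldNormedType.Exports.

Local Open Scope classical_set_scope.
Local Open Scope ring_scope.

(** * Maps of class C^r *)

(** [X] is only a semiflow, so leaves cannot be pulled back by an inverse flow. The substitute is a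
    factor 1/2 in the comparison of flow lines: over a time [tau] with [m L tau <= 1/4], the
    transverse difference of two flow lines changes by at most half its initial size, so a
    difference that vanishes at time [t] vanished already at time 0. With all coordinates instead of
    the transverse ones, the same estimate makes [X t] a perturbation of the identity with Lipschitz
    constant 1/2, to which the contraction principle applies. The bump function is there because the
    bracket condition speaks of sections over all of M, whereas the fields [d_a] live in a chart. A
    common [tau] is indispensable: a point is lifted from leaf to leaf again and again, and the time
    steps have to add up to arbitrarily large times. Boundedness of [E] is all that attraction asks
    for. A leaf may a priori meet a chart in countably many plaques that accumulate; embeddedness is
    what leaves a single one near a given point. *)

Lemma diff_near {R : numFieldType} {V W : normedModType R} (f : V -> W) (x : V) :
  differentiable f x -> forall e : R, 0 < e ->
  \forall y \near x, `|f y - f x - 'd f x (y - x)| <= e * `|y - x|.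
Proof.
move=> /diff_locally df e e0.
move: df => /eqaddoP /(_ e e0) df.
rewrite (near_shift 0) subr0; near=> h => /=.
rewrite addrK.
near: h.
by apply: filterS df => h /=; rewrite fctE /= opprD addrA.
Unshelve. all: by end_near. Qed.

Lemma near_diff {R : numFieldType} {V W : normedModType R} (f : V -> W)
    (df : {linear V -> W}) (x : V) : continuous df ->
  (forall e : R, 0 < e ->
    \forall y \near x, `|f y - f x - df (y - x)| <= e * `|y - x|) ->
  is_diff x f df.
Proof.
move=> cdf H.
have E : f \o shift x = cst (f x) + df +o_0 id.
  apply/eqaddoP => e e0.
  have := H e e0; rewrite (near_shift 0) subr0; apply: filterS => h /=.
  by rewrite addrK fctE /= opprD addrA.
have dE := diff_unique cdf E.
by split => //; apply/diff_locallyP; rewrite dE.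
Qed.

Lemma near_eq_differentiable {R : numFieldType} {V W : normedModType R}
    (f g : V -> W) (x : V) :
  {near x, f =1 g} -> differentiable f x -> differentiable g x.
Proof.
move=> fg df; have [] // : is_diff x g ('d f x).
apply: near_diff; first exact: diff_continuous.
move=> e e0; have := diff_near df e0; rewrite (nbhs_singleton fg) => H.
by near=> y; rewrite -(near fg y)//; near: y.
Unshelve. all: by end_near. Qed.

(* [F] may be a one-sided filter, as at the initial time of a semiflow. *)
Lemma chain_rule_cvg {R : numFieldType} {V W : normedModType R} (f : V -> W)
    (F : set_system R) (FF : Filter F) (c : R -> V) (x w : V) :
  differentiable f x ->  c @ F --> x ->
  h^-1 *: (c h - x) @[h --> F] --> w ->
  h^-1 *: (f (c h) - f x) @[h --> F] --> 'd f x w.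
Proof.
move=> df cx cw; apply/cvgrPdist_lt => e e0.
have cdf : {for w, continuous ('d f x)} by exact: diff_continuous.
have H1 : \forall h \near F, `|'d f x w - 'd f x (h^-1 *: (c h - x))| < e / 2.
  by move/cvgrPdist_lt: (cvg_comp _ _ cw cdf); apply; rewrite divr_gt0.
have N0 : 0 < `|w| + 1 by rewrite ltr_wpDl.
have H2 : \forall h \near F, `|h^-1 *: (c h - x)| < `|w| + 1.
  move/cvgrPdist_lt: cw => /(_ 1 ltr01); apply: filterS => h hw.
  rewrite -ltrBlDl; apply: le_lt_trans hw.
  by rewrite distrC; exact: lerB_dist.
have e2 : 0 < e / 2 / (`|w| + 1) by rewrite divr_gt0 // divr_gt0.
have H3 := cx _ (diff_near df e2).
near=> h.
have -> : h^-1 *: (f (c h) - f x) = h^-1 *: (f (c h) - f x - 'd f x (c h - x))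
    + 'd f x (h^-1 *: (c h - x)).
  by rewrite linearZ -scalerDr subrK.
rewrite opprD addrCA (le_lt_trans (ler_normD _ _))// (splitr e) ler_ltD //;
  last by near: h; exact: H1.
rewrite normrN normrZ.
have : `|f (c h) - f x - 'd f x (c h - x)| <= e / 2 / (`|w| + 1) * `|c h - x|.
  by near: h.
have h2 : `|h^-1 *: (c h - x)| < `|w| + 1 by near: h.
rewrite normrZ in h2 => h3.
rewrite (le_trans (ler_wpM2l _ h3))// mulrCA.
rewrite (le_trans (ler_wpM2l (ltW e2) (ltW h2)))//.
by rewrite divfK // gt_eqF.
Unshelve. all: by end_near. Qed.

Lemma rV_norm_leP {R : realType} {m : nat} (x : 'rV[R]_m) (e : R) : 0 <= e ->
  `|x| <= e <-> forall j, `|x 0 j| <= e.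
Proof.
move=> e0; rewrite /Num.Def.normr/= mx_normrE; split=> [xe j|xe].
  exact: le_trans (le_bigmax _ (fun i => `|x i.1 i.2|) (0, j)) xe.
by apply: bigmax_le => // -[i j] _ /=; rewrite [i]ord1; exact: xe.
Qed.

Lemma coord_le_norm {R : realType} {m : nat} (x : 'rV[R]_m) j : `|x 0 j| <= `|x|.
Proof. exact: (rV_norm_leP _ (normr_ge0 x)).1. Qed.

Lemma cvg_rowP {R : realType} {m : nat} (T : Type) (F : set_system T)
    {FF : Filter F} (f : T -> 'rV[R]_m) (l : 'rV[R]_m) :
  f @ F --> l <-> forall j, (f x 0 j : R^o) @[x --> F] --> (l 0 j : R^o).
Proof.
split=> [fl j|fl].
  by apply: (cvg_comp f (fun M : 'rV[R]_m => M 0 j : R^o) fl); exact: coord_continuous.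
apply/cvgrPdist_le => e e0; near=> x.
apply/rV_norm_leP; first exact: ltW.
move=> j; rewrite !mxE; move: j; near: x; apply: filter_forall => j.
by move/cvgrPdist_le: (fl j); exact.
Unshelve. all: by end_near. Qed.

Section Ck_calculus.
Context {R : realType} {n : nat}.
Implicit Types (D : set 'rV[R]_n) (r : nat).

(** Equality on an open set persists near each of its points, so it passes to directional
    derivatives. *)
Lemma eq_Ck (W : normedModType R) r D (f g : 'rV[R]_n -> W) : open D ->
  (forall x, D x -> f x = g x) -> Ck r D f -> Ck r D g.
Proof.
move=> oD; have nD x : D x -> \forall y \near x, D y.
  by move=> Dx; apply: open_nbhs_nbhs.
elim: r f g => [|r IH] f g fg /=.
  move=> cf x Dx; rewrite /prop_for /continuous_at -fg //.
  have fgx : {near x, f =1 g} by apply: filterS (nD x Dx) => y /fg.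
  exact: cvg_trans (near_eq_cvg fgx) (cf x Dx).
move=> [df Dr]; split.
  move=> x Dx; apply: near_eq_differentiable (df x Dx).
  by apply: filterS (nD x Dx) => y /fg.
move=> v; apply: IH (Dr v) => x Dx; apply: near_eq_derive.
by apply: filterS (nD x Dx) => y /fg.
Qed.

Lemma sub_Ck (W : normedModType R) r D (E : set 'rV[R]_n) (f : 'rV[R]_n -> W) :
  D `<=` E -> Ck r E f -> Ck r D f.
Proof.
move=> DE; elim: r f => [|r IH] f /=; first by move=> + x /DE; exact.
by move=> [df Ef]; split=> [x /DE /df//|v]; exact: IH.
Qed.

Lemma CkW (W : normedModType R) r D (f : 'rV[R]_n -> W) :
  Ck r.+1 D f -> Ck r D f.
Proof.
elim: r f => [|r IH] f [df Df].
  by move=> x Dx; apply: differentiable_continuous (df x Dx).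
by split=> // v; exact: IH (Df v).
Qed.

Lemma Ck_cst (W : normedModType R) r D (a : W) : Ck r D (cst a).
Proof.
elim: r a => [|r IH] a; first by move=> x _; exact: cst_continuous.
split=> [x _|v]; first exact: differentiable_cst.
rewrite (_ : (fun x => _) = cst 0) //.
by apply/funext => x; rewrite derive_cst.
Qed.

Lemma Ck_add (W : normedModType R) r D (f g : 'rV[R]_n -> W) : open D ->
  Ck r D f -> Ck r D g -> Ck r D (fun x => f x + g x).
Proof.
move=> oD; elim: r f g => [|r IH] f g /=.
  by move=> cf cg x Dx; apply: continuousD; [exact: cf|exact: cg].
move=> [df Df] [dg Dg]; split.
  by move=> x Dx; apply: differentiableD; [exact: df|exact: dg].
move=> v; apply: eq_Ck (IH _ _ (Df v) (Dg v)) => // x Dx.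
by rewrite deriveD //; apply/diff_derivable; [exact: df|exact: dg].
Qed.

Lemma Ck_sum r D (W : normedModType R) (m : nat) (f : 'I_m -> 'rV[R]_n -> W) :
  open D -> (forall i, Ck r D (f i)) -> Ck r D (fun x => \sum_i f i x).
Proof.
move=> oD; elim: m f => [|m IH] f cf.
  by under eq_fun do rewrite big_ord0; exact: Ck_cst.
under eq_fun do rewrite big_ord_recl.
by apply: Ck_add => //; exact: IH.
Qed.

Lemma Ck_mul r D (f g : 'rV[R]_n -> R^o) : open D ->
  Ck r D f -> Ck r D g -> Ck r D (fun x => f x * g x : R^o).
Proof.
move=> oD; elim: r f g => [|r IH] f g.
  by move=> cf cg x Dx; apply: continuousM; [exact: cf|exact: cg].
move=> cf cg; have [df Df] := cf; have [dg Dg] := cg; split.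
  by move=> x Dx; apply: differentiableM; [exact: df|exact: dg].
move=> v.
apply: (@eq_Ck _ _ _ (fun x => f x * 'D_v g x + g x * 'D_v f x : R^o)) => //.
  by move=> x Dx; rewrite deriveM //; apply/diff_derivable; [exact: df|exact: dg].
by apply: Ck_add => //; apply: IH; [exact: CkW|exact: Dg|exact: CkW|exact: Df].
Qed.

Lemma derive_coord (m : nat) (f : 'rV[R]_n -> 'rV[R]_m) (x v : 'rV[R]_n) j :
  derivable f x v -> 'D_v (fun y => f y 0 j : R^o) x = ('D_v f x) 0 j.
Proof. by move=> df; rewrite derive_mx // mxE. Qed.

Lemma differentiable_rowP (V : normedModType R) (m : nat) (f : V -> 'rV[R]_m) x :
  differentiable f x <-> forall j, differentiable (fun y => f y 0 j : R^o) x.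
Proof.
split=> [df j|df].
  apply: (@differentiable_comp _ _ _ _ f (fun M : 'rV[R]_m => M 0 j : R^o)) => //.
  exact: differentiable_coord.
have -> : f = \sum_j (fun y => (f y 0 j : R^o) *: (delta_mx 0 j : 'rV[R]_m)).
  by apply/funext => y; rewrite fct_sumE -row_sum_delta.
by apply: differentiable_sum => j; exact: differentiableZl.
Qed.

Lemma CkP (m : nat) r D (f : 'rV[R]_n -> 'rV[R]_m) : open D ->
  Ck r D f <-> forall j, Ck r D (fun x => f x 0 j : R^o).
Proof.
move=> oD; elim: r f => [|r IH] f.
  split=> [cf j x Dx|cf x Dx].
    apply: (@continuous_comp _ _ _ f (fun M : 'rV[R]_m => M 0 j : R^o)).
      exact: cf.
    exact: coord_continuous.
  exact: ((@cvg_rowP _ _ _ (nbhs x) _ f (f x)).2 (fun j => cf j x Dx)).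
split=> [[df Df] j|cf].
  split=> [x Dx|v]; first by move/differentiable_rowP: (df x Dx); exact.
  have /(_ j) := (IH _).1 (Df v); apply: eq_Ck => // x Dx.
  by rewrite derive_coord //; apply/diff_derivable/df.
have df x : D x -> differentiable f x.
  by move=> Dx; apply/differentiable_rowP => j; apply: (cf j).1.
split=> // v; apply/IH => j; have /(_ v) := (cf j).2; apply: eq_Ck => // x Dx.
by rewrite derive_coord //; apply/diff_derivable/df.
Qed.

Lemma Ck_linear r D (W : normedModType R) (f : {linear 'rV[R]_n -> W}) :
  continuous f -> Ck r D f.
Proof.
move=> cf; case: r => [|r]; first by move=> x _; exact: cf.
split=> [x _|v]; first exact: linear_differentiable.
rewrite (_ : (fun x => _) = cst (f v)); first exact: Ck_cst.
by apply/funext => x; rewrite deriveE ?diff_lin //; exact: linear_differentiable.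
Qed.

Lemma Ck_coord r D (j : 'I_n) : Ck r D (fun x => x 0 j : R^o).
Proof.
have lin : linear (fun x : 'rV[R]_n => x 0 j : R^o).
  by move=> a u v; rewrite !mxE.
pose L := GRing.isLinear.Build _ _ _ _ _ lin.
pose f : {linear 'rV[R]_n -> R^o} := HB.pack (fun x : 'rV[R]_n => x 0 j : R^o) L.
exact: (@Ck_linear r D _ f (@coord_continuous _ _ _ _ _)).
Qed.

End Ck_calculus.

Section Ck_composition.
Context {R : realType} {n m : nat}.

Lemma derive_comp (W : normedModType R) (g : 'rV[R]_n -> W)
    (f : 'rV[R]_m -> 'rV[R]_n) x v :
  differentiable f x -> differentiable g (f x) ->
  'D_v (g \o f) x = 'D_('D_v f x) g (f x).
Proof.
move=> df dg; rewrite !deriveE //; last exact: differentiable_comp.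
by rewrite diff_comp.
Qed.

Lemma derive_sum_coord (W : normedModType R) (g : 'rV[R]_n -> W) x v :
  differentiable g x -> 'D_v g x = \sum_j v 0 j *: 'D_(delta_mx 0 j) g x.
Proof.
move=> dg; rewrite deriveE // [in LHS](row_sum_delta v) linear_sum /=.
by apply: eq_bigr => j _; rewrite linearZ /= deriveE.
Qed.

(** Scalar values keep the induction going: the chain rule writes the derivative as a sum of
    products of coordinates of ['D_v f] with partial derivatives of [g], to which [Ck_mul]
    applies. *)
Lemma Ck_comp_fct r (D : set 'rV[R]_m) (E : set 'rV[R]_n) (g : 'rV[R]_n -> R^o)
    (f : 'rV[R]_m -> 'rV[R]_n) : open D -> (forall x, D x -> E (f x)) ->
  Ck r E g -> Ck r D f -> Ck r D (g \o f).
Proof.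
move=> oD DE; elim: r g => [|r IH] g.
  by move=> cg cf x Dx; apply: continuous_comp; [exact: cf|exact/cg/DE].
move=> [dg Dg] cf; have [df Df] := cf; split.
  by move=> x Dx; apply: differentiable_comp; [exact: df|exact/dg/DE].
move=> v.
apply: (@eq_Ck _ _ _ _ _ (fun x => \sum_j ('D_v f x 0 j *
  ('D_(delta_mx 0 j) g \o f) x : R^o))) => //.
  move=> x Dx; rewrite derive_comp; [|exact: df|exact/dg/DE].
  by rewrite derive_sum_coord //; exact/dg/DE.
apply: Ck_sum => // j; apply: Ck_mul => //; last first.
  by apply: IH; [exact: Dg|exact: CkW].
exact: ((CkP r ('D_v f) oD).1 (Df v)).
Qed.

End Ck_composition.

Lemma Ck_comp {R : realType} {n m p : nat} r (D : set 'rV[R]_m)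
    (E : set 'rV[R]_n) (g : 'rV[R]_n -> 'rV[R]_p) (f : 'rV[R]_m -> 'rV[R]_n) :
  open D -> open E -> (forall x, D x -> E (f x)) ->
  Ck r E g -> Ck r D f -> Ck r D (g \o f).
Proof.
move=> oD oE DE cg cf; apply/CkP => // j.
apply: (@Ck_comp_fct _ _ _ _ _ E (fun x => g x 0 j : R^o)) => //.
exact: ((CkP r g oE).1 cg).
Qed.

Lemma is_diff_shift {R : numFieldType} {V : normedModType R} (a z : V) :
  is_diff z (fun y : V => y + a) id.
Proof.
apply: (@near_diff _ _ _ (fun y : V => y + a) idfun); first by move=> x; exact: cvg_id.
move=> e e0; apply: nearW => y.
by rewrite /= opprD addrACA subrr addr0 subrr normr0 mulr_ge0 // ltW.
Qed.

Lemma derive_translate {R : numFieldType} {V W : normedModType R} (f : V -> W)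
  (a z u : V) : 'D_u (fun y => f (y + a)) z = 'D_u f (z + a).
Proof.
have E : (fun h : R => h^-1 *: (((fun y => f (y + a)) \o shift z) (h *: u) - f (z + a)))
    = (fun h : R => h^-1 *: ((f \o shift (z + a)) (h *: u) - f (z + a))).
  by apply/funext => h /=; rewrite addrA.
by rewrite /derive E.
Qed.

(** Made for the two mixed second derivatives, which the mean value theorem shows to agree only at
    two different points near [x]. *)
Lemma continuous_eq_of_near {R : realFieldType} {V : normedModType R} (f g : V -> R^o) (x : V) :
  {for x, continuous f} -> {for x, continuous g} ->
  (forall d : R, 0 < d -> exists y z, [/\ `|x - y| < d, `|x - z| < d & f y = g z]) ->
  f x = g x.
Proof.
move=> cf cg H.
apply/eqP; rewrite -subr_eq0 -normr_le0; apply/ler_addgt0Pr => e e0; rewrite add0r.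
have e2 : 0 < e / 2 by rewrite divr_gt0.
move/cvgrPdist_lt : cf => /(_ _ e2)/nbhs_ballP[a a0 aH].
move/cvgrPdist_lt : cg => /(_ _ e2)/nbhs_ballP[b b0 bH].
have [|y [z [xy xz E]]] := H (Num.min a b); first by rewrite lt_min; apply/andP.
have ya : `|f x - f y| < e / 2.
  by apply: aH; rewrite -ball_normE /=; apply: lt_le_trans xy _; rewrite ge_min lexx.
have zb : `|g x - g z| < e / 2.
  by apply: bH; rewrite -ball_normE /=; apply: lt_le_trans xz _; rewrite ge_min lexx orbT.
rewrite -(subrKA (f y)) (le_trans (ler_normD _ _)) // (splitr e).
by rewrite lerD ?(ltW ya) // E distrC (ltW zb).
Qed.

(** * Mean value estimates and symmetry of second derivatives *)

Section mean_value.
Context {R : realType} {n : nat}.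
Implicit Types (x y u v w : 'rV[R]_n).

Lemma is_derive_line (W : normedModType R) (f : 'rV[R]_n -> W) x v (t : R) :
  derivable f (x + t *: v) v ->
  is_derive t 1 (fun s : R => f (x + s *: v)) ('D_v f (x + t *: v)).
Proof.
move=> df.
have E : (fun h : R => h^-1 *: (((fun s : R => f (x + s *: v)) \o shift t) (h *: 1)
    - f (x + t *: v))) = (fun h : R => h^-1 *: ((f \o shift (x + t *: v)) (h *: v)
    - f (x + t *: v))).
  apply/funext => h /=; congr (_ *: (f _ - _)).
  by rewrite [h%:A]mulr1 scalerDl addrCA.
by apply: DeriveDef; rewrite /derivable /derive E.
Qed.

Lemma mvt_line (f : 'rV[R]_n -> R^o) x v (s : R) : 0 <= s ->
  (forall t, 0 <= t <= s -> differentiable f (x + t *: v)) ->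
  exists2 t, 0 <= t <= s & f (x + s *: v) - f x = s * 'D_v f (x + t *: v).
Proof.
move=> s0 df.
have dl t : 0 <= t <= s ->
    is_derive t 1 (fun r : R => f (x + r *: v)) ('D_v f (x + t *: v)).
  by move=> ts; apply/is_derive_line/diff_derivable/df.
have [||t ts E] := @MVT_segment R (fun r : R => f (x + r *: v))
  (fun r => 'D_v f (x + r *: v)) 0 s s0.
- by move=> t; rewrite in_itv /= => /andP[? ?]; apply: dl; rewrite !ltW.
- apply: continuous_in_subspaceT => t; rewrite inE /= in_itv /= => ts.
  by apply: differentiable_continuous; apply/derivable1_diffP; have [] := dl t ts.
exists t; first by move: ts; rewrite in_itv.
by move: E; rewrite scale0r addr0 subr0 mulrC.
Qed.

Lemma ball_segment y0 (r : R) x y (t : R) : ball y0 r x -> ball y0 r y ->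
  0 <= t <= 1 -> ball y0 r (x + t *: (y - x)).
Proof.
rewrite -ball_normE /= => xr yr /andP[t0 t1].
have -> : y0 - (x + t *: (y - x)) = (1 - t) *: (y0 - x) + t *: (y0 - y).
  by apply/rowP => j; rewrite !mxE; ring.
rewrite (le_lt_trans (ler_normD _ _)) // !normrZ !ger0_norm ?subr_ge0 //.
have [->|tn] := eqVneq t 0; first by rewrite subr0 mul1r mul0r addr0.
have tp : 0 < t by rewrite lt_def tn.
rewrite (lt_le_trans (y := (1 - t) * r + t * r)) //; last first.
  by rewrite -mulrDl subrK mul1r.
by rewrite ler_ltD // ?ltr_pM2l // ler_wpM2l // ?subr_ge0 // ltW.
Qed.

(** The derivative along the segment from [x] to [y] is a sum over the coordinates in which those
    outside [P] drop out, so displacements in these directions do not enter the bound. For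
    transverse velocities, the position inside a plaque thus becomes irrelevant. *)
Lemma partial_mean_value (g : 'rV[R]_n -> R^o) (P : pred 'I_n) y0 (r L E : R) x y :
  0 <= L -> 0 <= E ->
  (forall z, ball y0 r z -> differentiable g z) ->
  (forall z l, ball y0 r z -> P l -> `|'D_(delta_mx 0 l) g z| <= L) ->
  (forall z l, ball y0 r z -> ~~ P l -> 'D_(delta_mx 0 l) g z = 0) ->
  ball y0 r x -> ball y0 r y ->
  (forall l, P l -> `|y 0 l - x 0 l| <= E) ->
  `|g y - g x| <= n%:R * L * E.
Proof.
move=> L0 E0 dg gL g0 xr yr xyE.
have [t t01 Et] : exists2 t, 0 <= t <= 1 &
    g (x + 1 *: (y - x)) - g x = 1 * 'D_(y - x) g (x + t *: (y - x)).
  by apply: mvt_line => // t t01; apply/dg/ball_segment.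
move: Et; rewrite scale1r mul1r (addrC x (y - x)) subrK => ->.
have zr := ball_segment xr yr t01.
rewrite derive_sum_coord; last exact: dg.
rewrite (le_trans (ler_norm_sum _ _ _)) // -mulrA mulr_natl.
rewrite -[X in _ *+ X]card_ord -sumr_const; apply: ler_sum => l _.
have [Pl|nPl] := boolP (P l); last first.
  by rewrite g0 // scaler0 normr0 mulr_ge0.
by rewrite normrM !mxE mulrC ler_pM // ?gL // xyE.
Qed.

(** Mean value theorem twice: in direction [u] for [z |-> f (z + h v) - f z], then in direction [v]
    for ['D_u f]. *)
Lemma second_difference (f : 'rV[R]_n -> R^o) (D : set 'rV[R]_n) x u v (h : R) :
  Ck 2 D f -> 0 < h ->
  (forall s t, 0 <= s <= h -> 0 <= t <= h -> D (x + s *: u + t *: v)) ->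
  exists s t, [/\ 0 <= s <= h, 0 <= t <= h &
    (f (x + h *: u + h *: v) - f (x + h *: u)) - (f (x + h *: v) - f x)
    = h * h * 'D_v ('D_u f) (x + s *: u + t *: v)].
Proof.
move=> [df Df] h0 Dst; have lh : 0 <= h <= h by rewrite lexx ltW.
have l0 : 0 <= (0 : R) <= h by rewrite lexx ltW.
pose g z := f (z + h *: v) - f z.
have shiftE (t : R) z := is_diff_shift (t *: v) z.
have dft s t : 0 <= s <= h -> 0 <= t <= h ->
    differentiable (fun z => f (z + t *: v)) (x + s *: u).
  move=> sh th.
  by apply: (@differentiable_comp _ _ _ _ (fun z => z + t *: v) f) => //; exact/df/Dst.
have dft0 s : 0 <= s <= h -> differentiable f (x + s *: u).
  by move=> sh; apply: df; have := Dst _ _ sh l0; rewrite scale0r addr0.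
have Dft s t : 0 <= s <= h -> 0 <= t <= h ->
   'D_u (fun z => f (z + t *: v)) (x + s *: u) = 'D_u f (x + s *: u + t *: v).
  by move=> sh th; exact: derive_translate.
have [|s sh Es] := @mvt_line g x u h (ltW h0).
  by move=> s sh; apply: differentiableB; [exact: dft|exact: dft0].
have [|t th Et] := @mvt_line ('D_u f) (x + s *: u) v h (ltW h0).
  by move=> t th; apply: (Df u).1; exact: Dst.
exists s, t; split => //.
rewrite -[LHS]/(g (x + h *: u) - g x) Es -mulrA; congr (_ * _); rewrite -Et.
rewrite deriveB; [|exact/diff_derivable/dft|exact/diff_derivable/dft0].
by rewrite Dft.
Qed.

(** Schwarz's theorem: the second difference is symmetric in [u] and [v], so both mixed derivatives
    take the value of its quotient by [h * h] somewhere in an arbitrarily small parallelogram at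
    [x]. *)
Lemma derive_sym (f : 'rV[R]_n -> R^o) (D : set 'rV[R]_n) x u v :
  open D -> D x -> Ck 2 D f -> 'D_v ('D_u f) x = 'D_u ('D_v f) x.
Proof.
move=> oD Dx cf; have Dx' : \forall y \near x, D y by exact: open_nbhs_nbhs.
have [df Df] := cf.
have /nbhs_ballP[d0 d00 dD] := Dx'.
apply: (continuous_eq_of_near ((Df u).2 v x Dx) ((Df v).2 u x Dx)) => d1 d10.
pose d := Num.min d0 d1; have dp : 0 < d by rewrite lt_min; apply/andP.
have N0 : 0 < `|u| + `|v| + 1 by rewrite ltr_wpDl // addr_ge0.
(* The parallelogram with sides [h u] and [h v] has to stay within distance [d] of [x]; the summand
   1 makes the bound strict and covers [u = v = 0]. *)
pose h := d / (`|u| + `|v| + 1); have h0 : 0 < h by rewrite divr_gt0.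
have near s t : 0 <= s <= h -> 0 <= t <= h -> `|x - (x + s *: u + t *: v)| < d.
  move=> /andP[s0 sh] /andP[t0 th].
  rewrite -addrA opprD addrA subrr add0r normrN (le_lt_trans (ler_normD _ _)) //.
  rewrite !normrZ !ger0_norm //.
  rewrite (le_lt_trans (lerD (ler_wpM2r (normr_ge0 _) sh) (ler_wpM2r (normr_ge0 _) th))) //.
  by rewrite -mulrDr /h mulrAC ltr_pdivrMr // ltr_pM2l // ltrDl.
have dH y : `|x - y| < d -> D y.
  move=> xy; apply: dD; rewrite -ball_normE /=.
  by apply: lt_le_trans xy _; rewrite ge_min lexx.
have [s [t [sh th E1]]] : exists s t, [/\ 0 <= s <= h, 0 <= t <= h & _] :=
  second_difference cf h0 (fun s t sh th => dH _ (near s t sh th)).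
have near' s' t' : 0 <= s' <= h -> 0 <= t' <= h -> `|x - (x + s' *: v + t' *: u)| < d.
  by move=> sh' th'; rewrite addrAC; exact: near.
have [s' [t' [sh' th' E2]]] : exists s t, [/\ 0 <= s <= h, 0 <= t <= h & _] :=
  second_difference cf h0 (fun s t sh th => dH _ (near' s t sh th)).
have dd1 : d <= d1 by rewrite ge_min lexx orbT.
exists (x + s *: u + t *: v), (x + s' *: v + t' *: u); split.
- exact: lt_le_trans (near _ _ sh th) dd1.
- exact: lt_le_trans (near' _ _ sh' th') dd1.
apply: (@mulfI _ (h * h)); first by rewrite mulf_neq0 // gt_eqF.
apply: etrans (esym E1) (etrans _ E2); rewrite (addrAC x (h *: v) (h *: u)).
by rewrite !opprB [LHS]addrACA [RHS]addrACA; congr (_ + _); exact: addrC.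
Qed.

End mean_value.

(** * The smooth function that vanishes on a half line *)

Section smooth_bump.
Context {R : realType}.

(* Extended by 0 to the nonpositive half line, where inversion would otherwise
   give a nonzero value. *)
Definition flat_exp (j : nat) (x : R) : R :=
  if 0 < x then x^-1 ^+ j * expR (- x^-1) else 0.

(** For [y = 1/x], a single term of the exponential series gives [y^(j+1) <= (j+1)! e^y], hence
    [y^j e^(-y) <= (j+1)! x]. *)
Lemma flat_exp_le (j : nat) (x : R) : 0 <= flat_exp j x <= (j.+1)`!%:R * `|x|.
Proof.
rewrite /flat_exp; case: ifP => [x0|_]; last by rewrite lexx mulr_ge0.
have y0 : 0 < x^-1 by rewrite invr_gt0.
rewrite mulr_ge0 ?expR_ge0 ?exprn_ge0 ?(ltW y0) //= gtr0_norm // expRN.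
have F0 : 0 < (j.+1)`!%:R :> R by rewrite ltr0n fact_gt0.
have E0 := expR_gt0 x^-1.
rewrite ler_pdivrMr //.
have := @expR_ge1Dxn R x^-1 j (ltW y0) => H.
have {}H : x^-1 ^+ j.+1 / (j.+1)`!%:R <= expR x^-1.
  by apply: le_trans H; rewrite lerDr.
rewrite -mulrA (le_trans _ (ler_wpM2l (ltW F0) (ler_wpM2l (ltW x0) H))) //.
by rewrite exprS [x * _]mulrA [x * _]mulrA mulfV ?gt_eqF // mul1r mulrC divfK ?gt_eqF.
Qed.

(** The powers of [x^-1] make the family closed under differentiation up to linear combinations. At
    0 the difference quotient of member [j] is, for positive increments, member [j.+1], which tends
    to 0 by [flat_exp_le]. *)
Lemma is_derive_flat_exp (j : nat) (x : R) :
  is_derive x 1 (flat_exp j) (flat_exp j.+2 x - j%:R * flat_exp j.+1 x).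
Proof.
have [x0|x0|x0] := ltgtP 0 x; last rewrite -x0.
- have ne : \forall y \near x, y^-1 ^+ j * expR (- y^-1) = flat_exp j y.
    have : \forall y \near x, 0 < y by exact: lt_nbhsr.
    by apply: filterS => y y0; rewrite /flat_exp y0.
  apply: (near_eq_is_derive ne).
  have xn : x != 0 by rewrite gt_eqF.
  have dV : is_derive x 1 (fun y : R => y^-1) (- x ^- 2).
    apply: is_derive_eq (@is_deriveV _ id x 1 1 xn (is_derive_id _ _)) _.
    by rewrite [_ *: _]mulr1.
  have dN : is_derive x 1 (fun y : R => - y^-1) (x ^- 2).
    by apply: is_derive_eq (is_deriveN dV) _; rewrite opprK.
  have dE : is_derive x 1 (fun y : R => expR (- y^-1)) (expR (- x^-1) * x ^- 2).
    exact: (@is_derive1_comp _ expR (fun y : R => - y^-1)).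
  have dX := is_deriveX j dV.
  rewrite [X in is_derive x 1 X](_ : _ =
    ((fun y : R => y^-1) ^+ j) * (fun y : R => expR (- y^-1))); last first.
    by apply/funext => y; rewrite fctE exprfctE.
  apply: is_derive_eq (is_deriveM dX dE) _.
  rewrite /flat_exp x0 /GRing.scale /= exprfctE.
  rewrite -exprVn.
  case: (j) => [|i] /=; first by rewrite !mul0r !expr0; ring.
  by rewrite !exprS; ring.
- apply: (@near_eq_is_derive _ _ _ (cst 0)).
    have : \forall y \near x, y < 0 by exact: lt_nbhsl.
    by apply: filterS => y y0; rewrite /flat_exp ltNge (ltW y0).
  by rewrite /flat_exp !ltNge (ltW x0) /= mulr0 subr0; exact: is_derive_cst.
rewrite /flat_exp ltxx mulr0 subr0.
suff H : h^-1 *: ((flat_exp j \o shift 0) (h *: 1) - flat_exp j 0)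
    @[h --> 0^'] --> (0 : R).
  by apply: DeriveDef; [apply/cvg_ex; exists 0|exact: cvg_lim].
apply/cvgrPdist_le => e e0.
have F0 : 0 < (j.+2)`!%:R :> R by rewrite ltr0n fact_gt0.
near=> h; rewrite /= addr0 [h%:A]mulr1 /flat_exp ltxx subr0 sub0r normrN.
have [h0|h0] := ltP 0 h; last by rewrite scaler0 normr0 ltW.
rewrite [_ *: _]mulrA -exprS ger0_norm.
  have /andP[_] := flat_exp_le j.+1 h; rewrite /flat_exp h0 => /le_trans; apply.
  rewrite mulrC -ler_pdivlMr //; near: h.
  by apply: dnbhs0_le; rewrite divr_gt0.
by rewrite mulr_ge0 ?expR_ge0 // exprn_ge0 // invr_ge0 ltW.
Unshelve. all: by end_near. Qed.

Lemma Ck_flat_exp (n : nat) r (D : set 'rV[R]_n) (q : 'rV[R]_n -> R^o) j :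
  open D -> (forall k, Ck k D q) -> Ck r D (fun x => flat_exp j (q x) : R^o).
Proof.
move=> oD cq.
have dF i x : differentiable (flat_exp i : R -> R^o) x.
  by apply/derivable1_diffP; have [] := is_derive_flat_exp i x.
elim: r j => [|r IH] j.
  move=> x Dx; apply: (@continuous_comp _ _ _ q (flat_exp j : R -> R^o)).
    exact: (cq 0%N).
  exact: differentiable_continuous.
have dq x : D x -> differentiable q x by exact: (cq 1%N).1.
have cD x : D x -> differentiable (fun x => flat_exp j (q x) : R^o) x.
  by move=> Dx; apply: (@differentiable_comp _ _ _ _ q (flat_exp j : R -> R^o)) => //; exact: dq.
split=> // v.
apply: (@eq_Ck _ _ _ _ _ (fun x =>
  (flat_exp j.+2 (q x) + (- j%:R) * flat_exp j.+1 (q x)) * 'D_v q x : R^o)) => //.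
  move=> x Dx; rewrite [RHS]deriveE; last exact: cD.
  rewrite (@diff_comp _ _ _ _ q (flat_exp j : R -> R^o)) //; last exact: dq.
  rewrite /= -[X in _ = 'd _ _ X]mulr1 [RHS]linearZ /= -(deriveE (1 : R) (dF j (q x))).
  rewrite -(deriveE v (dq x Dx)); have [_ ->] := is_derive_flat_exp j (q x).
  by rewrite [RHS]mulrC mulNr.
apply: Ck_mul => //; last exact: (cq r.+1).2.
apply: Ck_add; [by []|exact: IH|].
apply: (@Ck_mul _ _ _ _ (cst (- j%:R))); [by []|exact: Ck_cst|exact: IH].
Qed.

End smooth_bump.

(** * Global attractors *)

Section compactness.
Context {T : topologicalType}.

(** Compactness in its near-covering form, for the filter of properties shared by all sufficiently
    large lists: near [x], every list that contains [x] will do. *)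
Lemma compact_finite_cover (A : set T) (N : T -> set T) : compact A ->
  (forall p, A p -> open (N p) /\ N p p) ->
  exists s : seq T, forall q, A q -> exists p, [/\ p \in s, A p & N p q].
Proof.
move=> /compact_near_coveringP cA oN.
pose F : set_system (seq T) := [set S | exists s0 : seq T, forall s : seq T,
  {subset s0 <= s} -> S s].
have FF : Filter F.
  split; first by exists [::].
    move=> P Q [s Ps] [t Qt]; exists (s ++ t) => u stu.
    split; [apply: Ps|apply: Qt] => p ps; apply: stu; rewrite mem_cat ps //.
    by rewrite orbT.
  by move=> P Q PQ [s Ps]; exists s => t st; apply/PQ/Ps.
have [|s sA] := cA _ F (fun s q => exists p, [/\ p \in s, A p & N p q]) FF.
  move=> x Ax; have [oNx Nxx] := oN x Ax.
  exists (N x, [set s : seq T | x \in s]).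
    split; first by apply: open_nbhs_nbhs.
    by exists [:: x] => s; apply; rewrite inE.
  by move=> [q s] [/= Nq xs]; exists x.
by exists s; exact: sA.
Qed.

(** If a proper filter [F] on [A] had no cluster point, the basic open sets whose complement is in
    [F] (the set [C]) would cover [A]. Finitely many of them are avoided by a set of [F], so there
    is a point [x n] of [A] outside all members of [C] numbered up to [n]. A subsequential limit
    would lie in some member of [C], which then contains [x n] for arbitrarily large [n]: a
    contradiction. *)
Lemma seq_compact_compact (A : set T) : @second_countable T ->
  (forall x : nat -> T, (forall n, A (x n)) -> exists (f : nat -> nat) p,
    [/\ forall j k, (j < k)%N -> (f j < f k)%N, A p & x \o f @ \oo --> p]) ->
  compact A.
Proof.
move=> [B /countable_injP[num numI] [Bo Bb]] sA F PF FA.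
apply: contrapT => nF.
pose C := [set b | B b /\ F (~` b)].
have cover p : A p -> exists2 b, C b & b p.
  move=> Ap; apply: contrapT => nC; apply: nF; exists p; split=> // G H FG.
  move=> /(Bb p)[b [Bb' bp] bH]; apply: contrapT => GH.
  apply: nC; exists b => //; split=> //; apply: filterS FG => q Gq bq.
  by apply: GH; exists q; split=> //; exact: bH.
have FC n : F [set q | forall b, C b -> (num b <= n)%N -> ~ b q].
  elim: n => [|n IH].
    have [[b [Cb b0]]|nb] := pselect (exists b, C b /\ (num b <= 0)%N).
      apply: filterS (Cb.2) => q bq b' Cb' b'0; suff -> : b' = b by [].
      apply: numI; rewrite ?inE; [exact: Cb'.1|exact: Cb.1|].
      by move: b0 b'0; rewrite !leqn0 => /eqP-> /eqP->.
    by apply: filterS filterT => q _ b Cb b0; case: nb; exists b.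
  have [[b [Cb b0]]|nb] := pselect (exists b, C b /\ num b = n.+1).
    apply: filterS (filterI IH Cb.2) => q [IHq bq] b' Cb'.
    rewrite leq_eqVlt => /orP[/eqP b'n|]; last by rewrite ltnS; exact: IHq.
    suff -> : b' = b by [].
    by apply: numI; rewrite ?inE; [exact: Cb'.1|exact: Cb.1|rewrite b'n].
  apply: filterS IH => q IHq b Cb; rewrite leq_eqVlt => /orP[/eqP b0|]; last first.
    by rewrite ltnS; exact: IHq.
  by case: nb; exists b.
have /choice[x xP] : forall n, exists q, A q /\ forall b, C b -> (num b <= n)%N -> ~ b q.
  by move=> n; have [q [? ?]] := filter_ex (filterI FA (FC n)); exists q.
have [|f [p [finc Ap xp]]] := sA x; first by move=> n; exact: (xP n).1.
have fge n : (n <= f n)%N.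
  by elim: n => // n IH; apply: leq_ltn_trans IH _; exact: finc.
have [b Cb bp] := cover p Ap.
have : nbhs p b by apply: open_nbhs_nbhs; split=> //; apply: Bo; exact: Cb.1.
move=> /xp[N _ HN].
apply: ((xP (f (maxn N (num b)))).2 b Cb).
  by apply: leq_trans (fge _); rewrite leq_maxr.
by apply: HN; rewrite /= leq_maxl.
Qed.

End compactness.

Section attractor.
Context {R : realType} {T : topologicalType}.
Variables (M : set T) (d : T -> T -> R) (X : R -> T -> T).
Hypotheses (hd : distance_on M d).

Lemma distance_refl p : M p -> d p p = 0.
Proof. by move=> Mp; have [H _ _ _] := hd; apply/H. Qed.

Lemma distance_ge0 p q : M p -> M q -> 0 <= d p q.
Proof.
move=> Mp Mq; have [_ sym tri _] := hd.
have := tri p q p Mp Mq Mp; rewrite distance_refl // (sym q p) // -mulr2n.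
by rewrite pmulrn_lge0.
Qed.

Lemma distance_nbhs p (e : R) : M p -> 0 < e ->
  exists2 G, open G /\ G p & forall q, M q -> G q -> d p q < e.
Proof.
move=> Mp e0; have [_ _ _ top] := hd.
have : within M (nbhs p) [set q | d p q < e] by apply: (top p Mp _).2; exists e.
rewrite /within /= nbhsE => -[G [oG Gp] GM]; exists G => // q Mq Gq.
exact: (GM q).
Qed.

Lemma nbhs_distance p G : M p -> nbhs p G ->
  exists2 e : R, 0 < e & forall q, M q -> d p q < e -> G q.
Proof.
move=> Mp nG; have [_ _ _ top] := hd; apply/top => //.
by apply: filterS nG => q Gq _.
Qed.

Lemma compact_bounded_in A : A `<=` M -> compact A -> bounded_in d A.
Proof.
move=> AM; have [[p Ap]|nA] := pselect (exists p, A p); last first.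
  by move=> _; exists 0 => p q Ap; case: nA; exists p.
have Mp := AM p Ap; have [_ sym tri _] := hd.
move=> /compact_near_coveringP cA.
have [|C [Cr HC]] := cA R +oo (fun C q => A q -> d p q <= C) _.
  move=> x Ax; have [G [oG Gx] GM] := distance_nbhs (AM x Ax) ltr01.
  exists (G, [set C | d p x + 1 <= C]).
    split; first exact: open_nbhs_nbhs.
    by apply: nbhs_pinfty_ge; rewrite num_real.
  move=> [q C] [/= Gq CC] Aq; apply: le_trans CC.
  have Mx := AM x Ax; have Mq := AM q Aq.
  by rewrite (le_trans (tri p x q _ _ _)) // lerD2l ltW // GM.
have C1 : C < C + 1 by rewrite ltrDl.
exists ((C + 1) + (C + 1)) => q r Aq Ar.
rewrite (le_trans (tri q p r _ _ _)) //; try exact: AM.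
rewrite lerD //; last exact: (HC _ C1 _ Ar Ar).
by rewrite sym //; [exact: (HC _ C1 _ Aq Aq)|exact: AM].
Qed.

Lemma dist_to_lt p A (e : R) :
  (dist_to d p A < e%:E)%E <-> exists2 q, A q & d p q < e.
Proof.
split=> [|[q Aq pq]].
  by move/ereal_inf_lt => [_ [q Aq <-]]; rewrite lte_fin; exists q.
apply: le_lt_trans (_ : (d p q)%:E < e%:E)%E; last by rewrite lte_fin.
by apply: ereal_inf_lbound; exists q.
Qed.

Lemma mem_of_dist p A : hausdorff_space T -> A `<=` M -> compact A -> M p ->
  (forall e : R, 0 < e -> exists2 q, A q & d p q < e) -> A p.
Proof.
move=> hT AM /(compact_closed hT) cA Mp H; apply: contrapT => nAp.
have [e e0 eH] : exists2 e : R, 0 < e & forall q, M q -> d p q < e -> (~` A) q.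
  by apply: nbhs_distance => //; apply: open_nbhs_nbhs; split=> //; exact: closed_openC.
by have [q Aq /eH] := H e e0; apply=> //; exact: AM.
Qed.

(** A set that covers itself at arbitrarily late times need not be invariant, but each of its points
    ends a long flow line starting in the bounded set [E], hence is arbitrarily close to [A].
    Applied to a second attractor this gives uniqueness; applied to the union of the leaves meeting
    [A], saturation. *)
Lemma sub_global_attractor A E : hausdorff_space T ->
  global_attractor M d X A -> E `<=` M -> bounded_in d E ->
  (forall t0 : R, exists2 t, t0 <= t & E `<=` X t @` E) -> E `<=` A.
Proof.
move=> hT [AM cA _ att] EM bE invE p Ep; apply: mem_of_dist => //; first exact: EM.
move=> e e0; have [t0 [_ Ht]] := att E EM bE e e0.
have [t tt0 /(_ p Ep)[x Ex <-]] := invE (t0 + 1).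
by apply/dist_to_lt/Ht => //; apply: lt_le_trans tt0; rewrite ltrDl.
Qed.

Lemma global_attractor_unique A A' : hausdorff_space T ->
  global_attractor M d X A -> global_attractor M d X A' -> A' = A.
Proof.
move=> hT gA gA'; apply/seteqP; split.
- have [A'M cA' invA' _] := gA'.
  apply: (sub_global_attractor hT gA) => //; first exact: compact_bounded_in.
  move=> t0; exists (Num.max t0 0); first by rewrite le_max lexx.
  by rewrite invA' // le_max lexx orbT.
- have [A'M cA' invA' _] := gA.
  apply: (sub_global_attractor hT gA') => //; first exact: compact_bounded_in.
  move=> t0; exists (Num.max t0 0); first by rewrite le_max lexx.
  by rewrite invA' // le_max lexx orbT.
Qed.

Lemma dist_to_ge0 p A : M p -> A `<=` M -> (0 <= dist_to d p A)%E.
Proof.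
move=> Mp AM; apply: le_ereal_inf_tmp => _ [q Aq <-].
by rewrite lee_fin distance_ge0 //; exact: AM.
Qed.

Lemma global_attractor_cvg A x : continuous_semiflow M X ->
  global_attractor M d X A -> M x -> dist_to d (X t x) A @[t --> +oo] --> 0%E.
Proof.
move=> [XM _ _ _] [AM _ _ att] Mx.
have b1 : bounded_in d [set x].
  by exists 0 => _ _ -> ->; rewrite distance_refl.
have xM : [set x] `<=` M by move=> _ ->.
have H (e : R) : 0 < e -> \forall t \near +oo,
    (0 <= dist_to d (X t x) A)%E /\ (dist_to d (X t x) A < e%:E)%E.
  move=> e0.
  have p0 : \forall t \near +oo, (0 : R) <= t by exact: nbhs_pinfty_ge.
  apply: filterS2 p0 (att _ xM b1 e e0) => t t0 Ht; split; last exact: Ht.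
  by apply: dist_to_ge0 => //; exact: XM.
apply/fine_cvgP; split.
  apply: filterS (H 1 ltr01) => t [h0 h1].
  rewrite fin_numE; apply/andP; split; first by rewrite gt_eqF // (lt_le_trans _ h0).
  by rewrite lt_eqF // (lt_trans h1) // ltry.
apply/cvgrPdist_lt => e e0; apply: filterS (H e e0) => t [h0 h1].
rewrite /= sub0r normrN; move: h0 h1; case: (dist_to d (X t x) A) => //= r.
by rewrite lee_fin lte_fin => r0 re; rewrite ger0_norm.
Qed.

(** The usual intersection over [t0] of the closures in M of the union of the images of [B] under
    [X t], [t >= t0]. The condition [0 <= t] matters because [t0] may be negative. *)
Definition omega_limit (B : set T) : set T := [set p | M p /\
  forall (e : R) (t0 : R), 0 < e ->
    exists t x, [/\ t0 <= t, 0 <= t, B x & d p (X t x) < e]].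

Section existence.
Hypotheses (hX : continuous_semiflow M X) (ac : asymptotically_compact M d X).
Variable (B : set T).
Hypothesis (hB : bounded_absorbing M d X B).

Lemma cvg_distance (u : nat -> T) p : M p -> (forall k, M (u k)) ->
  u @ \oo --> p <-> forall e : R, 0 < e -> \forall k \near \oo, d p (u k) < e.
Proof.
move=> Mp Mu; split=> [up e e0|H G nG].
  have [G [oG Gp] GM] := distance_nbhs Mp e0.
  have uG : \forall k \near \oo, G (u k) by apply: up; exact: open_nbhs_nbhs.
  by apply: filterS uG => k; exact: GM.
have [e e0 eG] := nbhs_distance Mp nG.
by apply: filterS (H e e0) => k; exact: eG.
Qed.

Lemma increasing_ge (f : nat -> nat) :
  (forall j k, (j < k)%N -> (f j < f k)%N) -> forall k, (k <= f k)%N.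
Proof. by move=> finc; elim=> // n IH; apply: leq_ltn_trans IH _; exact: finc. Qed.

Lemma cvg_pinfty_of_ge_nat (t : nat -> R) : (forall k, k%:R <= t k) -> t @ \oo --> +oo.
Proof.
move=> H; apply/cvgryPge => C; near=> k; apply: le_trans (H k).
by near: k; exact: nbhs_infty_ger.
Unshelve. all: by end_near. Qed.

(** The starting points may lie in any bounded [D]: after time [TD] they are in [B], and the
    semiflow law shifts this part of the time into the starting point. *)
Lemma limit_in_omega (D : set T) (t : nat -> R) (x : nat -> T) : D `<=` M ->
  bounded_in d D -> (forall k, D (x k)) -> (forall k, k%:R <= t k) ->
  exists (f : nat -> nat) p, [/\ forall j k, (j < k)%N -> (f j < f k)%N,
    omega_limit B p & (fun j => X (t (f j)) (x (f j))) @ \oo --> p].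
Proof.
move=> DM bD Dx tk.
have [BM bB abs] := hB; have [XM _ X_add _] := hX.
have [TD TD0 HTD] := abs D DM bD.
have t0 k : 0 <= t k by apply: le_trans (tk k).
have xM : range x `<=` M by move=> _ [k _ <-]; exact: DM.
have bx : bounded_in d (range x).
  by have [C HC] := bD; exists C => _ _ [j _ <-] [k _ <-]; exact: HC.
have [f [p [finc Mp cv]]] := ac xM bx t0 (cvg_pinfty_of_ge_nat tk).
exists f, p; split=> //; split=> // e s e0.
have Mu j : M (X (t (f j)) (x (f j))) by apply: XM => //; exact: DM.
have cv' := (cvg_distance Mp Mu).1 cv e e0.
(* [|s| + TD] leaves a remaining time [t (f j) - TD] that is both nonnegative and at least [s]. *)
have : \forall j \near \oo, `|s| + TD <= (j%:R : R) by exact: nbhs_infty_ger.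
move=> /(filterI cv')/filter_ex[j [/= dj sj]].
have tj : `|s| + TD <= t (f j).
  apply: le_trans sj (le_trans _ (tk (f j))).
  by rewrite ler_nat; exact: increasing_ge.
have tTD : 0 <= t (f j) - TD.
  by rewrite subr_ge0 (le_trans _ tj) // lerDr.
exists (t (f j) - TD), (X TD (x (f j))); split=> //.
- by rewrite lerBrDr (le_trans _ tj) // lerD2r ler_norm.
- by apply: (HTD TD) => //; exists (x (f j)).
- by rewrite -X_add ?subrK //; exact: DM.
Qed.

Lemma omega_limit_seq p : omega_limit B p -> exists (t : nat -> R) (x : nat -> T),
  [/\ forall k, k%:R <= t k, forall k, B (x k) & (fun k => X (t k) (x k)) @ \oo --> p].
Proof.
move=> [Mp H]; have [BM _ _] := hB; have [XM _ _ _] := hX.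
have /choice[tx Htx] : forall k, exists tx : R * T, [/\ k%:R <= tx.1, 0 <= tx.1,
    B tx.2 & d p (X tx.1 tx.2) < k.+1%:R^-1].
  move=> k; have [t [x [? ? ? ?]]] := H k.+1%:R^-1 k%:R (ltac:(by rewrite invr_gt0)).
  by exists (t, x).
exists (fun k => (tx k).1), (fun k => (tx k).2); split.
- by move=> k; have [] := Htx k.
- by move=> k; have [] := Htx k.
apply/cvg_distance => //.
  by move=> k; have [_ ? ? _] := Htx k; apply: XM => //; exact: BM.
move=> e e0; near=> k; have [_ _ _] := Htx k; move/lt_trans; apply.
by near: k; exact: near_infty_natSinv_lt (PosNum e0).
Unshelve. all: by end_near. Qed.

Lemma semiflow_cvg (t : R) (u : nat -> T) p : 0 <= t -> M p -> (forall k, M (u k)) ->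
  u @ \oo --> p -> (fun k => X t (u k)) @ \oo --> X t p.
Proof.
move=> t0 Mp Mu up; have [_ _ _ cX] := hX.
have cv : (fun k => (t, u k)) @ \oo --> ((t, p) : R * T).
  by apply: (cvg_pair (cvg_cst t) up).
have H' := (subspace_continuousP _ _).1 cX (t, p) (conj t0 Mp).
move=> G nG; have := H' G nG; rewrite /within /= => /cv.
rewrite !nbhs_simpl /=.
by apply: filterS => k; apply; split=> //=.
Qed.

(** Compactness, the existence of preimages under [X t] and attraction each rest on a limit supplied
    by [limit_in_omega]; forward invariance rests on the continuity of [X t]. *)
Lemma omega_limit_attractor : hausdorff_space T -> @second_countable T ->
  global_attractor M d X (omega_limit B).
Proof.
move=> hT sT; have [BM bB abs] := hB; have [XM X0 X_add _] := hX.
have seq_sub (u : nat -> T) (f : nat -> nat) (p : T) :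
    (forall j k, (j < k)%N -> (f j < f k)%N) -> u @ \oo --> p -> u \o f @ \oo --> p.
  move=> finc up; apply: cvg_comp up => A [N _ NA]; exists N => // k /= Nk.
  by apply: NA => /=; apply: leq_trans Nk _; exact: increasing_ge.
split.
- by move=> p [].
- apply: seq_compact_compact => // p Ap.
  have /choice[tx Htx] : forall k, exists tx : R * T, [/\ k%:R <= tx.1, 0 <= tx.1,
      B tx.2 & d (p k) (X tx.1 tx.2) < k.+1%:R^-1].
    move=> k; have [t [x [? ? ? ?]]] := (Ap k).2 k.+1%:R^-1 k%:R (ltac:(by rewrite invr_gt0)).
    by exists (t, x).
  have [||f [q [finc oq cv]]] := @limit_in_omega B (fun k => (tx k).1) (fun k => (tx k).2) BM bB.
  + by move=> k; have [] := Htx k.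
  + by move=> k; have [] := Htx k.
  exists f, q; split=> //.
  have Mu k : M (X (tx (f k)).1 (tx (f k)).2).
    by have [_ ? ? _] := Htx (f k); apply: XM => //; exact: BM.
  have Mq : M q by case: oq.
  apply/(cvg_distance Mq) => [k|e e0]; first exact: (Ap _).1.
  have e2 : 0 < e / 2 by rewrite divr_gt0.
  have := (cvg_distance Mq Mu).1 cv _ e2 => cv2.
  near=> k; have [_ sym tri _] := hd.
  rewrite (le_lt_trans (tri q (X (tx (f k)).1 (tx (f k)).2) (p (f k)) _ _ _)) //.
    exact: (Ap _).1.
  rewrite (splitr e) ltrD //; first by near: k.
  rewrite sym //; last exact: (Ap _).1.
  have [_ _ _ /lt_trans] := Htx (f k); apply.
  apply: le_lt_trans (_ : k.+1%:R^-1 < e / 2).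
    by rewrite lef_pV2 ?posrE // ler_nat ltnS; exact: increasing_ge.
  by near: k; exact: near_infty_natSinv_lt (PosNum e2).
- move=> t t0; apply/seteqP; split.
    move=> _ [p op <-]; have [s [x [sk Bx cv]]] := omega_limit_seq op.
    have s0 k : 0 <= s k by apply: le_trans (sk k).
    have Mp : M p by case: op.
    have cv' := semiflow_cvg t0 Mp (fun k => XM _ _ (s0 k) (BM _ (Bx k))) cv.
    have Mu k : M (X t (X (s k) (x k))) by apply: (XM) => //; apply: XM => //; exact: BM.
    split; first exact: XM.
    move=> e r e0; have := (cvg_distance (XM _ _ t0 Mp) Mu).1 cv' e e0.
    have : \forall k \near \oo, `|r| <= (k%:R : R) by exact: nbhs_infty_ger.
    move=> nr /(filterI nr)/filter_ex[k [/= rk dk]].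
    exists (t + s k), (x k); split=> //.
    + by rewrite (le_trans (ler_norm r)) // (le_trans rk) // (le_trans (sk k)) // lerDr.
    + by rewrite addr_ge0.
    + by rewrite X_add //; exact: BM.
  move=> p op; have [s [x [sk Bx cv]]] := omega_limit_seq op.
  have [N HN] : exists N : nat, t <= N%:R.
    by exists (Num.truncn t).+1; rewrite ltW // truncnS_gt.
  (* A preimage of [p] under [X t] is a limit at the times [s - t]; dropping the first [N >= t]
     terms keeps the [k]-th time at least [k]. *)
  pose s' k := s (k + N)%N - t; pose x' k := x (k + N)%N.
  have sk' k : k%:R <= s' k.
    by rewrite lerBrDr (le_trans _ (sk _)) // natrD lerD2l.
  have s'0 k : 0 <= s' k by apply: le_trans (sk' k).
  have [|f [q [finc oq cvq]]] := @limit_in_omega B s' x' BM bB _ sk'.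
    by move=> k; exact: Bx.
  exists q => //; have Mq : M q by case: oq.
  have c1 := semiflow_cvg t0 Mq (fun k => XM _ _ (s'0 _) (BM _ (Bx _))) cvq.
  have c2 : (fun j => X t (X (s' (f j)) (x' (f j)))) @ \oo --> p.
    have -> : (fun j => X t (X (s' (f j)) (x' (f j)))) =
        (fun k => X (s k) (x k)) \o (fun j => (f j + N)%N).
      apply/funext => j /=; rewrite -X_add ?s'0 //; last exact/BM/Bx.
      by rewrite /s' addrC subrK.
    by apply: seq_sub cv => i j ij; rewrite ltn_add2r finc.
  exact: (cvg_unique hT c1 c2).
- move=> D DM bD e e0; apply: contrapT => nH.
  (* Points violating the bound at arbitrarily late times would have a limit in the omega-limit set,
     to which they come closer than [e]. *)
  have /choice[tx Htx] : forall k : nat, exists tx : R * T, [/\ k%:R <= tx.1,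
      D tx.2 & ~ (dist_to d (X tx.1 tx.2) (omega_limit B) < e%:E)%E].
    move=> k; apply: contrapT => nk; apply: nH.
    have p0 : \forall t \near +oo, (k%:R : R) <= t.
      by apply: nbhs_pinfty_ge; rewrite num_real.
    apply: filterS p0 => t kt x Dx; apply: contrapT => nd.
    by apply: nk; exists (t, x).
  have [||f [p [finc op cv]]] := @limit_in_omega D (fun k => (tx k).1) (fun k => (tx k).2) DM bD.
  + by move=> k; have [] := Htx k.
  + by move=> k; have [] := Htx k.
  have Mp : M p by case: op.
  have Mu k : M (X (tx (f k)).1 (tx (f k)).2).
    have [t0 ? _] := Htx (f k); apply: XM; last exact: DM.
    by apply: le_trans t0.
  have /filter_ex[k dk] := (cvg_distance Mp Mu).1 cv e e0.
  have [_ _] := Htx (f k); apply; apply/dist_to_lt; exists p => //.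
  by have [_ sym _ _] := hd; rewrite sym.
Unshelve. all: by end_near. Qed.

End existence.

End attractor.

(** * Comparison of integral curves *)

Section one_sided_derivative.
Context {R : realType}.

(* The notion of velocity used in [solution_family]: two-sided for [0 < s] and
   one-sided at [s = 0]. *)
Definition has_velocity (V : normedModType R) (c : R -> V) (s : R) (w : V) :=
  h^-1 *: (c (s + h) - c s) @[h --> within [set h : R | 0 <= s + h] (0 : R)^'] --> w.

Lemma has_velocity_coord (m : nat) (c : R -> 'rV[R]_m) s w j :
  has_velocity c s w -> has_velocity (fun u => c u 0 j : R^o) s (w 0 j : R^o).
Proof.
move=> /cvg_rowP/(_ j); rewrite /has_velocity; apply: cvg_trans.
by apply: near_eq_cvg; apply: nearW => h /=; rewrite !mxE.
Qed.

Lemma has_velocity_is_derive (V : normedModType R) (c : R -> V) s w :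
  0 < s -> has_velocity c s w -> is_derive s 1 c w.
Proof.
move=> s0 cw.
suff H : h^-1 *: ((c \o shift s) (h *: 1) - c s) @[h --> 0^'] --> w.
  by apply: DeriveDef; [apply/cvg_ex; exists w|exact: cvg_lim].
move=> A /cw; rewrite /= nbhs_simpl /= /within /= => HA.
have ns : \forall h \near (0 : R)^', - s < h.
  apply: nbhs_dnbhs; apply: lt_nbhsr.
  by rewrite oppr_lt0.
apply: filterS2 ns HA => h sh Ah /=; rewrite [h%:A]mulr1 (addrC h s).
by apply: Ah; rewrite -lerBlDl sub0r ltW.
Qed.

Lemma has_velocity_right (V : normedModType R) (c : R -> V) s w : 0 <= s ->
  has_velocity c s w -> h^-1 *: (c (s + h) - c s) @[h --> (0 : R)^'+] --> w.
Proof.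
move=> s0; apply: cvg_trans => A HA.
have {}HA : nbhs (0 : R) (fun h => h != 0 -> 0 <= s + h ->
  A (h^-1 *: (c (s + h) - c s))) by [].
have : nbhs (0 : R) (fun h => 0 < h -> A (h^-1 *: (c (s + h) - c s))) by
  apply: filterS HA => h Ah h0; apply: Ah; rewrite ?gt_eqF // addr_ge0 // ltW.
by [].
Qed.

Lemma has_velocity_unique (V : normedModType R) (c : R -> V) s w w' : 0 <= s ->
  has_velocity c s w -> has_velocity c s w' -> w = w'.
Proof.
move=> s0 /(has_velocity_right s0) cw /(has_velocity_right s0) cw'.
exact: (cvg_unique _ cw cw').
Qed.

Lemma near_eq_has_velocity (V : normedModType R) (c c' : R -> V) s w :
  c s = c' s ->
  (\forall h \near within [set h : R | 0 <= s + h] (0 : R)^', c (s + h) = c' (s + h)) ->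
  has_velocity c s w -> has_velocity c' s w.
Proof.
move=> cs cc; apply: cvg_trans; apply: near_eq_cvg.
by apply: filterS cc => h ->; rewrite cs.
Qed.

Lemma has_velocity_comp (V W : normedModType R) (f : V -> W) (c : R -> V) s w :
  differentiable f (c s) ->
  c (s + h) @[h --> within [set h : R | 0 <= s + h] (0 : R)^'] --> c s ->
  has_velocity c s w -> has_velocity (f \o c) s ('d f (c s) w).
Proof. by move=> df cc cw; apply: chain_rule_cvg cc cw. Qed.

(** At time 0 only a right-sided velocity is at hand; it still gives the continuity at the left
    endpoint that the mean value theorem on [[0, s]] requires. *)
Lemma has_velocity_cvg (f : R -> R^o) (w : R^o) :
  has_velocity f 0 w -> f x @[x --> 0^'+] --> f 0.
Proof.
move=> fw.
have qw : h^-1 * (f h - f 0) @[h --> 0^'+] --> w.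
  apply: cvg_trans (has_velocity_right (lexx 0) fw).
  by apply: near_eq_cvg; apply: nearW => h; rewrite add0r.
have H : h * (h^-1 * (f h - f 0)) + f 0 @[h --> 0^'+] --> 0 * w + f 0.
  apply: cvgD; last exact: cvg_cst.
  apply: cvgM => //.
  by apply: cvg_within_filter; exact: cvg_id.
rewrite mul0r add0r in H; apply: cvg_trans H; apply: near_eq_cvg.
have : \forall h \near 0^'+, (0 : R) < h by exact: nbhs_right_gt.
by apply: filterS => h h0; rewrite mulrA mulfV ?gt_eqF // mul1r subrK.
Qed.

Lemma velocity_mean_value (f df : R -> R^o) (s : R) : 0 < s ->
  (forall u, 0 <= u <= s -> has_velocity f u (df u)) ->
  exists2 u, 0 <= u <= s & f s - f 0 = df u * s.
Proof.
move=> s0 fv.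
have fd u : 0 < u <= s -> is_derive u 1 f (df u).
  by move=> /andP[u0 us]; apply: has_velocity_is_derive => //; apply: fv; rewrite ltW.
have cf u : 0 < u <= s -> {for u, continuous f}.
  move=> us; apply: differentiable_continuous; apply/derivable1_diffP.
  by have [] := fd u us.
have [||u us E] := @MVT R f df 0 s s0.
- by move=> u; rewrite in_itv /= => /andP[u0 us]; apply: fd; rewrite u0 ltW.
- apply/continuous_within_itvP => //; split.
  + by move=> u; rewrite in_itv /= => /andP[u0 us]; apply: cf; rewrite u0 ltW.
  + by apply: (has_velocity_cvg (w := df 0)); apply: fv; rewrite lexx ltW.
  + by apply: cvg_within_filter; apply: cf; rewrite s0 lexx.
exists u; last by rewrite E subr0.
by move: us; rewrite in_itv /= => /andP[? ?]; rewrite !ltW.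
Qed.

End one_sided_derivative.

HB.instance Definition _ (R : realType) (m n : nat) := NormedModule.on 'M[R]_(m, n).

Section perturbation.
Context {R : realType} {m : nat}.

(** A preimage of [y] is a fixed point of [z |-> y - (P z - z)]. This map contracts by 1/2 and sends
    the closed [r]-ball about [x] into itself: half of the radius is spent on [y - P x], half on the
    contraction. *)
Lemma perturbed_identity_onto (P : 'rV[R]_m -> 'rV[R]_m) x (r : R) y : 0 <= r ->
  (forall z z', `|z - x| <= r -> `|z' - x| <= r ->
    `|(P z - P z') - (z - z')| <= 2^-1 * `|z - z'|) ->
  `|y - P x| <= r / 2 -> exists2 z, `|z - x| <= r & P z = y.
Proof.
move=> r0 HP Hy.
pose U := [set z : 'rV[R]_m | `|z - x| <= r].
pose f z := y - (P z - z).
have Ux : U x by rewrite /U /= subrr normr0.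
have fU : set_fun U U f.
  move=> z Uz; rewrite /U /= /f.
  have -> : y - (P z - z) - x = (y - P x) - ((P z - P x) - (z - x)).
    by rewrite !opprB; apply/rowP => j; rewrite !mxE; ring.
  rewrite (le_trans (ler_normB _ _)) // (splitr r) lerD //.
  by rewrite (le_trans (HP _ _ Uz Ux)) // mulrC ler_wpM2r.
have ctr : is_contraction (mkfun fU).
  exists (2^-1)%:nng; split => /=; first by rewrite invf_lt1 // ltr1n.
  move=> [z z'] [/= Uz Uz']; rewrite /f.
  have -> : y - (P z - z) - (y - (P z' - z')) = - ((P z - P z') - (z - z')).
    by rewrite !opprB; apply/rowP => j; rewrite !mxE; ring.
  by rewrite normrN; exact: HP.
have cU : closed U.
  have -> : U = closed_ball_ Num.norm x r.
    by apply/funext => z; rewrite /U /closed_ball_ /= distrC.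
  exact: closed_closed_ball_.
have [z Uz] := banach_fixed_point ctr cU (ex_intro _ x Ux).
rewrite /= /f => Ez; exists z => //.
by have := congr1 (fun u => u + (P z - z)) Ez; rewrite subrK addrC subrK.
Qed.

End perturbation.

Section flow_comparison.
Context {R : realType} {m : nat}.
Variables (v : 'rV[R]_m -> 'rV[R]_m) (y0 : 'rV[R]_m) (r L tau : R) (P : pred 'I_m).
Hypotheses (L0 : 0 <= L) (tauL : m%:R * L * tau <= 4^-1).
Hypothesis dv : forall z j, ball y0 r z -> differentiable (fun z => v z 0 j : R^o) z.
Hypothesis vL : forall z j l, ball y0 r z ->
  `|'D_(delta_mx 0 l) (fun z => v z 0 j : R^o) z| <= L.
(* Taken with [P] the transverse directions, this says that the transverse
   components of the velocity are constant along the plaques. *)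
Hypothesis vP : forall z j l, ball y0 r z -> P j -> ~~ P l ->
  'D_(delta_mx 0 l) (fun z => v z 0 j : R^o) z = 0.

(** Takes the place of Gronwall's inequality. Let [S] be the supremum of the [P]-differences over
    the time interval. By the mean value theorem and [m L tau <= 1/4], each difference changes by at
    most [S / 4]; so [S <= E + S / 4], and the change is at most [S / 4 <= E / 3]. Bounding the
    change rather than the size allows conclusions from time [t] back to time 0. *)
Lemma flow_comparison (c1 c2 : R -> 'rV[R]_m) (E t : R) :
  (forall s, 0 <= s <= tau -> ball y0 r (c1 s) /\ has_velocity c1 s (v (c1 s))) ->
  (forall s, 0 <= s <= tau -> ball y0 r (c2 s) /\ has_velocity c2 s (v (c2 s))) ->
  (forall j, P j -> `|c1 0 0 j - c2 0 0 j| <= E) -> 0 <= t <= tau ->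
  forall j, P j ->
    `|(c1 t 0 j - c2 t 0 j) - (c1 0 0 j - c2 0 0 j)| <= E / 2.
Proof.
move=> h1 h2 hE tt j0 Pj0.
have E0 : 0 <= E by apply: le_trans (hE _ Pj0).
pose dl j s := c1 s 0 j - c2 s 0 j.
have tau0 : 0 <= tau by case/andP: tt => /le_trans; exact.
pose W := [set w : R | exists s j, [/\ 0 <= s <= tau, P j & w = `|dl j s|]].
have W0 : W !=set0 by exists `|dl j0 t|, t, j0.
have ubW : ubound W (r + r).
  move=> _ [s [j [st Pj ->]]]; have [b1 _] := h1 s st; have [b2 _] := h2 s st.
  move: b1 b2; rewrite -ball_normE /= => b1 b2.
  have -> : dl j s = (y0 - c2 s) 0 j - (y0 - c1 s) 0 j by rewrite !mxE /dl; ring.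
  rewrite (le_trans (ler_normB _ _)) // lerD //.
    by rewrite (le_trans (coord_le_norm _ _)) // ltW.
  by rewrite (le_trans (coord_le_norm _ _)) // ltW.
have hW : has_sup W by split=> //; exists (r + r).
have leS s j : 0 <= s <= tau -> P j -> `|dl j s| <= sup W.
  by move=> st Pj; apply: sup_upper_bound => //; exists s, j.
have S0 : 0 <= sup W by apply: le_trans (leS t j0 tt Pj0).
have key s j : 0 <= s <= tau -> P j -> `|dl j s - dl j 0| <= sup W / 4.
  move=> /andP[s0 st] Pj.
  have [->|sn] := eqVneq s 0; first by rewrite subrr normr0 divr_ge0.
  have sp : 0 < s by rewrite lt_def sn.
  pose df u := v (c1 u) 0 j - v (c2 u) 0 j : R^o.
  have [u us|u us ->] := @velocity_mean_value _ (dl j : R -> R^o) df s sp.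
    have ut : 0 <= u <= tau by case/andP: us => -> /le_trans ->.
    have := @has_velocity_coord _ _ _ _ _ j (h1 u ut).2.
    have := @has_velocity_coord _ _ _ _ _ j (h2 u ut).2.
    rewrite /has_velocity => H2 H1; apply: (cvg_trans _ (cvgB H1 H2)).
    apply: near_eq_cvg; apply: nearW => h /=.
    by rewrite fctE /dl -scalerBr; congr (_ *: _); ring.
  have ut : 0 <= u <= tau by case/andP: us => -> /le_trans ->.
  rewrite normrM (ger0_norm s0).
  have := @partial_mean_value _ _ (fun z => v z 0 j : R^o) P y0 r L (sup W)
    (c2 u) (c1 u) L0 S0 (fun z => dv j) (fun z l zr _ => vL j l zr)
    (fun z l zr => vP zr Pj) (h2 u ut).1 (h1 u ut).1 (fun l Pl => leS u l ut Pl).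
  move=> H; rewrite (le_trans (ler_pM _ _ H st)) //.
  by rewrite mulrAC mulrC ler_wpM2l.
have S1 : sup W <= E + sup W / 4.
  apply: ge_sup => // _ [s [j [st Pj ->]]].
  rewrite -(subrK (dl j 0) (dl j s)) addrC (le_trans (ler_normD _ _)) // lerD //.
    exact: hE.
  exact: key.
apply: le_trans (key t j0 tt Pj0) _.
lra.
Qed.

End flow_comparison.

(** * Charts *)

Lemma open_setI_preimage {T T' : topologicalType} (f : T -> T') (D : set T)
    (B : set T') : open D -> open B -> (forall x, D x -> {for x, continuous f}) ->
  open (D `&` f @^-1` B).
Proof.
move=> oD oB cf; rewrite openE => x [Dx Bfx]; apply: filterI.
  by apply: open_nbhs_nbhs.
by apply: (cf x Dx); exact: open_nbhs_nbhs.
Qed.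

Section manifold_charts.
Context {R : realType} {n : nat} (U : smooth_manifold R n).
Implicit Types (i j : mchart U) (p q : U).
Local Notation phi := (@mphi R n U).
Local Notation psi := (@mpsi R n U).

Lemma open_chart_image i (G : set U) : open G -> open (phi i @` (mdom i `&` G)).
Proof.
move=> oG.
have -> : phi i @` (mdom i `&` G) = (phi i @` mdom i) `&` psi i @^-1` G.
  apply/seteqP; split=> [_ [q [dq Gq] <-]|_ [[q dq <-]]].
    by split; [exists q|rewrite /= mphiK].
  by rewrite /= mphiK // => Gq; exists q.
apply: open_setI_preimage => //; first exact: mimg_open.
by move=> x; exact: mpsi_continuous.
Qed.

Lemma chart_imageP i (G : set U) q : mdom i q ->
  (phi i @` (mdom i `&` G)) (phi i q) <-> G q.
Proof.
move=> dq; split=> [[q' [dq' Gq'] E]|Gq]; last by exists q.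
by rewrite -(mphiK dq) -E mphiK.
Qed.

Lemma open_chart_preimage i (D : set 'rV[R]_n) : open D ->
  open (mdom i `&` phi i @^-1` D).
Proof.
move=> oD; apply: open_setI_preimage => //; first exact: mdom_open.
by move=> q; exact: mphi_continuous.
Qed.

Lemma local_ext_le (W : normedModType R) (r r' : option nat) (A A' : set U)
    (f : U -> W) i p h : (forall D (g : 'rV[R]_n -> W), Cr r D g -> Cr r' D g) ->
  (forall q, A' q -> mdom i q -> A q) ->
  local_ext r A f i p h -> local_ext r' A' f i p h.
Proof.
move=> rr' AA' [D [oD Dp ch fh]]; exists D; split=> //; first exact: rr'.
by move=> q A'q dq; apply: fh => //; exact: AA'.
Qed.

Lemma Cr_SomeW (W : normedModType R) m r (D : set 'rV[R]_m) (f : 'rV[R]_m -> W) :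
  Cr (Some r.+1) D f -> Cr (Some r) D f.
Proof. exact: CkW. Qed.

Lemma dparam_dom m (s : 'rV[R]_m -> U) y w i : mdom i (s y) ->
  dparam s y w i = 'D_w (phi i \o s) y.
Proof. by move=> d; rewrite /dparam asboolT. Qed.

Lemma dparam_ndom m (s : 'rV[R]_m -> U) y w i : ~ mdom i (s y) ->
  dparam s y w i = 0.
Proof. by move=> d; rewrite /dparam asboolF. Qed.

End manifold_charts.

Section submanifold_chart.
Context {R : realType} {n : nat} (U : smooth_manifold R n).
Local Notation phi := (@mphi R n U).
Variables (m : nat) (M O : set U) (psi : U -> 'rV[R]_m) (s : 'rV[R]_m -> U).
Hypothesis hO : submfd_chart M O psi s.

Lemma submfd_chart_sub q : O q -> M q.
Proof. by have [[G oG ->] _ _ _ _] := hO => -[]. Qed.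

Lemma submfd_chart_paramK y : (psi @` O) y -> psi (s y) = y.
Proof. by have [_ _ sK _ _] := hO => -[q Oq <-]; rewrite sK. Qed.

Lemma submfd_chart_param y : (psi @` O) y -> O (s y).
Proof. by have [_ _ sK _ _] := hO => -[q Oq <-]; rewrite sK. Qed.

Definition param_dom (i : mchart U) := psi @` O `&` s @^-1` mdom i.

Lemma open_param_dom i : open (param_dom i).
Proof.
have [_ oQ _ _ [cs _]] := hO.
by apply: open_setI_preimage => //; exact: mdom_open.
Qed.

Lemma param_domP i q : O q -> mdom i q -> param_dom i (psi q).
Proof.
by move=> Oq dq; have [_ _ sK _ _] := hO; split; [exists q|rewrite /= sK].
Qed.

Lemma Ck_param r i : Ck r (param_dom i) (phi i \o s).
Proof. by have [_ _ _ _ [_ /(_ i)]] := hO; exact. Qed.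

Lemma differentiable_param i y : param_dom i y -> differentiable (phi i \o s) y.
Proof. exact: (Ck_param 1 i).1. Qed.

Lemma dparamZ i y a w : mdom i (s y) -> (psi @` O) y ->
  dparam s y (a *: w) i = a *: dparam s y w i.
Proof.
move=> d Qy; have dp := differentiable_param (conj Qy d).
by rewrite !dparam_dom // !deriveE // linearZ.
Qed.

Lemma near_param i p (D : set 'rV[R]_n) : O p -> mdom i p -> open D ->
  D (phi i p) -> \forall y \near psi p, param_dom i y /\ D (phi i (s y)).
Proof.
move=> Op dp oD Dp; have [_ _ sK _ _] := hO.
have oD' : open (param_dom i `&` (phi i \o s) @^-1` D).
  apply: open_setI_preimage; [exact: open_param_dom|exact: oD|].
  by move=> y Qy; apply: differentiable_continuous; exact: differentiable_param.
have : nbhs (psi p) (param_dom i `&` (phi i \o s) @^-1` D).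
  apply: open_nbhs_nbhs; split; first exact: oD'.
  by split; [exact: param_domP|rewrite /= sK].
exact.
Qed.

Lemma submfd_chart_ext i p : O p -> mdom i p ->
  exists (D : set 'rV[R]_n) (h : 'rV[R]_n -> 'rV[R]_m),
    [/\ open D, D (phi i p), forall r, Ck r D h &
      forall q, O q -> mdom i q -> D (phi i q) -> psi q = h (phi i q)].
Proof.
move=> Op dp; have [_ _ _ cpsi _] := hO.
have [h [D [oD Dp ch hE]]] := cpsi p i Op dp.
by exists D, h.
Qed.

(** The extension [h] of [psi] is a left inverse of [phi i \o s] near [psi p], so its differential
    recovers the parameter direction. Hence different directions have different images in U. *)
Lemma chart_param_id i p D (h : 'rV[R]_n -> 'rV[R]_m) w :
  O p -> mdom i p -> open D -> D (phi i p) -> Ck 1 D h ->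
  (forall q, O q -> mdom i q -> D (phi i q) -> psi q = h (phi i q)) ->
  'D_('D_w (phi i \o s) (psi p)) h (phi i p) = w.
Proof.
move=> Op dp oD Dp [dh _] hE; have [_ _ sK _ _] := hO.
have Qp := param_domP Op dp.
have dsig := differentiable_param Qp.
have E : phi i p = (phi i \o s) (psi p) by rewrite /= sK.
rewrite [in RHS](_ : w = 'D_w id (psi p)); last by rewrite derive_id.
rewrite [in LHS]E -derive_comp //; last by rewrite -E; exact: dh.
apply: near_eq_derive.
have := near_param Op dp oD Dp; apply: filterS => y [[Qy dy] Dy] /=.
by rewrite -hE ?submfd_chart_paramK //; exact: submfd_chart_param.
Qed.

(* [diff_on] chooses an extension; on a vector tangent to [M] the choice is
   immaterial because the derivative can be computed inside the chart. *)
Lemma diff_on_param (W : normedModType R) (f : U -> W) p (v : tvec U) w :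
  O p -> (exists h, local_ext (Some 1%N) M f (chart_at p) p h) ->
  v (chart_at p) = 'D_w (phi (chart_at p) \o s) (psi p) ->
  diff_on M f p v = 'D_w (f \o s) (psi p).
Proof.
move=> Op [h0 ex0] vE; have [_ _ sK _ _] := hO; rewrite /diff_on.
set i := chart_at p in ex0 vE *.
have dp : mdom i p by exact: mdom_cover.
have Qp := param_domP Op dp.
have dsig := differentiable_param Qp.
have E : phi i p = (phi i \o s) (psi p) by rewrite /= sK.
have key h : local_ext (Some 1%N) M f i p h ->
    'D_(v i) h (phi i p) = 'D_w (f \o s) (psi p).
  move=> [D [oD Dp [dh _] fh]].
  rewrite vE E -derive_comp //; last by rewrite -E; exact: dh.
  apply: near_eq_derive.
  have := near_param Op dp oD Dp; apply: filterS => y [[Qy dy] Dy] /=.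
  by rewrite -fh //; apply: submfd_chart_sub; exact: submfd_chart_param.
have [h /key <- <-] : [set 'D_(v i) h (phi i p) | h in local_ext (Some 1%N) M f i p]
    (xget 0 [set 'D_(v i) h (phi i p) | h in local_ext (Some 1%N) M f i p]).
  by apply: xgetPex; exists ('D_(v i) h0 (phi i p)), h0.
by [].
Qed.

End submanifold_chart.

(** * The vector field and its flow lines in a submanifold chart *)

Section chart_velocity.
Context {R : realType} {n : nat} (U : smooth_manifold R n).
Local Notation phi := (@mphi R n U).
Variables (m : nat) (M O : set U) (psi : U -> 'rV[R]_m) (s : 'rV[R]_m -> U).
Hypothesis hO : submfd_chart M O psi s.
Variables (V : U -> tvec U) (X : R -> U -> U).
Hypotheses (hV : vfield_on (Some 2%N) setT V) (hsol : solution_family M V X)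
  (hX : continuous_semiflow M X).

Lemma semiflow_cvg_time x t : M x -> 0 <= t ->
  X (t + h) x @[h --> within [set h : R | 0 <= t + h] (0 : R)^'] --> X t x.
Proof.
move=> Mx t0 A nA; have [_ _ _ cX] := hX.
have := (subspace_continuousP _ _).1 cX (t, x) (conj t0 Mx) A nA.
rewrite /= /within /= nbhs_simpl => H.
have ct : t + h @[h --> (0 : R)] --> t.
  rewrite -[X in _ --> X]addr0; apply: cvgD; [exact: cvg_cst|exact: cvg_id].
have c : (t + h, x) @[h --> (0 : R)] --> (t, x) by exact: (cvg_pair ct (cvg_cst x)).
have H1 : \forall h \near (0 : R), 0 <= t + h -> A (X (t + h) x).
  have {}H : \forall h \near (0 : R), 0 <= t + h /\ M x -> A (X (t + h) x) := c _ H.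
  by apply: filterS H => h Hh th; exact: (Hh (conj th Mx)).
have : \forall h \near (0 : R), h != 0 -> 0 <= t + h -> A (X (t + h) x).
  by apply: filterS H1 => h Hh _; exact: Hh.
by [].
Qed.

Lemma semiflow_near_chart x t i (G : set U) : M x -> 0 <= t -> O (X t x) ->
    mdom i (X t x) -> nbhs (X t x) G ->
  \forall h \near within [set h : R | 0 <= t + h] (0 : R)^',
    [/\ O (X (t + h) x), mdom i (X (t + h) x) & G (X (t + h) x)].
Proof.
move=> Mx t0 Ox dx nG; have [[W oW OE] _ _ _ _] := hO.
have [XM _ _ _] := hX.
have WX : W (X t x) by move: Ox; rewrite OE => -[].
have n1 : nbhs (X t x) (W `&` (mdom i `&` G)).
  apply: filterI; first exact: open_nbhs_nbhs.
  by apply: filterI => //; apply: open_nbhs_nbhs; split=> //; exact: mdom_open.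
have H := semiflow_cvg_time Mx t0 n1.
have H0 : \forall h \near within [set h : R | 0 <= t + h] (0 : R)^', 0 <= t + h.
  by apply: withinT.
apply: filterS2 H0 H => h th [Wh [dh Gh]]; split=> //.
by rewrite OE; split=> //; exact: XM.
Qed.

Lemma semiflow_cvg_chart x t i : M x -> 0 <= t -> mdom i (X t x) ->
  phi i (X (t + h) x) @[h --> within [set h : R | 0 <= t + h] (0 : R)^'] -->
  phi i (X t x).
Proof.
move=> Mx t0 dx.
exact: (cvg_comp _ _ (semiflow_cvg_time Mx t0) (mphi_continuous dx)).
Qed.

(** With [h] extending [psi] and [H] extending the components of [V], the chain rule for
    [psi = h \o phi i] along a flow line gives ['d h] applied to [H]. Class C^1 suffices for the
    Lipschitz bound and for the bracket. *)
Lemma chart_velocity p : O p -> exists (Q : set 'rV[R]_m) (v : 'rV[R]_m -> 'rV[R]_m),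
  [/\ open Q, Q (psi p), Q `<=` psi @` O, Ck 1 Q v &
    forall x t, M x -> 0 <= t -> O (X t x) -> Q (psi (X t x)) ->
      has_velocity (fun u => psi (X u x)) t (v (psi (X t x)))].
Proof.
move=> Op; set i := chart_at p; have dp : mdom i p by exact: mdom_cover.
have [D [h [oD Dp ch hE]]] := submfd_chart_ext hO Op dp.
have [H [E [oE Ep cH HE]]] := hV.2 i p i (conj I dp) dp.
pose sig := phi i \o s.
pose Q := param_dom O psi s i `&` sig @^-1` (D `&` E).
have [_ _ sK _ _] := hO.
have oQ : open Q.
  apply: open_setI_preimage; [exact: (open_param_dom hO)|exact: openI|].
  by move=> y Qy; apply: differentiable_continuous; exact: (differentiable_param hO).
(* Expanded in coordinates so that class C^1 follows from sums and products. *)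
pose v (y : 'rV[R]_m) := \sum_l H (sig y) 0 l *: 'D_(delta_mx 0 l) h (sig y).
have csig r : Ck r Q sig by apply: sub_Ck (Ck_param hO r i) => y [].
have vE y : Q y -> 'd h (sig y) (H (sig y)) = v y.
  by move=> [_ [Dy _]]; rewrite -deriveE ?derive_sum_coord //; exact: (ch 1%N).1.
exists Q, v; split.
- exact: oQ.
- by split; [exact: (param_domP hO Op dp)|rewrite /= /sig /= sK].
- by move=> y [[]].
- apply/(CkP _ _ oQ) => j.
  have E1 y : Q y -> \sum_l (H (sig y) 0 l * 'D_(delta_mx 0 l) h (sig y) 0 j) =
      v y 0 j.
    by move=> _; rewrite /v summxE; apply: eq_bigr => l _; rewrite mxE.
  apply: (eq_Ck oQ E1).
  apply: (Ck_sum (W := R^o)) => // l; apply: Ck_mul => //.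
    have cHs : Ck 1 Q (H \o sig).
      have cH1 : Ck 1 E H by exact: (@CkW _ _ _ 1 E H cH).
      by apply: (Ck_comp oQ oE _ cH1 (csig 1%N)) => y [_ []].
    exact: ((CkP 1 _ oQ).1 cHs l).
  have chs : Ck 1 Q ('D_(delta_mx 0 l) h \o sig).
    have ch1 : Ck 1 D ('D_(delta_mx 0 l) h) by exact: (ch 2%N).2.
    by apply: (Ck_comp oQ oD _ ch1 (csig 1%N)) => y [_ []].
  exact: ((CkP 1 _ oQ).1 chs j).
move=> x t Mx t0 Ox Qx; have [[_ dx] [Dx Ex]] := Qx.
rewrite /= sK // in dx; rewrite /= /sig /= sK // in Dx Ex.
have Vx : V (X t x) i = H (phi i (X t x)) by apply: HE.
rewrite -vE // /sig /= sK // -Vx.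
have hs := hsol Mx t0 dx.
have dh : differentiable h (phi i (X t x)) by exact: (ch 1%N).1.
have hv := has_velocity_comp (c := fun u => phi i (X u x)) dh
  (semiflow_cvg_chart Mx t0 dx) hs.
apply: near_eq_has_velocity hv; first by rewrite /= -hE.
have nD : nbhs (X t x) (mdom i `&` phi i @^-1` D).
  apply: open_nbhs_nbhs; split; last by [].
  exact: open_chart_preimage.
have := semiflow_near_chart Mx t0 Ox dx nD.
by apply: filterS => u [Ou du [_ Du]]; rewrite /= -hE.
Qed.

(** Converse of [chart_velocity]: pushed forward by [s], the coordinate velocity is a one-sided
    velocity of the flow line in U, and such velocities are unique. This expresses [V] by a
    parameter direction, as the bracket computation requires. *)
Lemma velocity_param y i w : (psi @` O) y -> mdom i (s y) ->
  has_velocity (fun u => psi (X u (s y))) 0 w -> V (s y) i = dparam s y w i.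
Proof.
move=> Qy dy cw; have [_ _ sK _ _] := hO; have [_ X0 _ _] := hX.
have Oy := submfd_chart_param hO Qy; have My := submfd_chart_sub hO Oy.
rewrite dparam_dom // deriveE; last exact: (differentiable_param hO).
have Oy' : O (X 0 (s y)) by rewrite X0.
have dy' : mdom i (X 0 (s y)) by rewrite X0.
have -> : V (s y) i = V (X 0 (s y)) i by rewrite X0.
apply: (has_velocity_unique (lexx 0) (hsol My (lexx 0) dy')).
have [D [h [oD Dp ch hE]]] := submfd_chart_ext hO Oy dy.
have cy : psi (X (0 + h) (s y)) @[h --> within [set h : R | 0 <= 0 + h] (0 : R)^'] -->
    psi (X 0 (s y)).
  rewrite [in X in _ --> X]X0 // hE //.
  have cc : h (phi i (X (0 + t) (s y))) @[t --> within [set h : R | 0 <= 0 + h] (0 : R)^'] -->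
     h (phi i (s y)).
    apply: cvg_comp; last exact: (ch 0%N _ Dp).
    have := semiflow_cvg_chart My (lexx 0) dy'.
    by rewrite [in X in _ --> X]X0.
  apply: cvg_trans cc; apply: near_eq_cvg.
  have nD : nbhs (X 0 (s y)) (mdom i `&` phi i @^-1` D).
    rewrite X0 //; apply: open_nbhs_nbhs; split; last by [].
    exact: open_chart_preimage.
  have := semiflow_near_chart My (lexx 0) Oy' dy' nD.
  by apply: filterS => u [Ou du [_ Du]]; rewrite -hE.
have ey : psi (X 0 (s y)) = y by rewrite X0 // (submfd_chart_paramK hO).
have ds : differentiable (phi i \o s) (psi (X 0 (s y))).
  by rewrite ey; exact: (differentiable_param hO).
have := has_velocity_comp (c := fun u => psi (X u (s y))) ds cy cw.
rewrite ey; apply: (near_eq_has_velocity (c' := fun u => phi i (X u (s y)))).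
  by rewrite /= sK.
have nT : nbhs (X 0 (s y)) setT by exact: filterT.
have := semiflow_near_chart My (lexx 0) Oy' dy' nT.
by apply: filterS => u [Ou _ _]; rewrite /= sK.
Qed.

End chart_velocity.

(** * The bracket with a cut-off coordinate field *)

Section derivative_along_field.
Context {R : realType} {m : nat}.
Variables (D : set 'rV[R]_m) (g : 'rV[R]_m -> R^o) (y : 'rV[R]_m).
Hypotheses (oD : open D) (Dy : D y) (cg : Ck 2 D g).

(** Product rule for the sum of the [v_l 'D_l g]: the field is differentiated in the first term and
    frozen at [y] in the second. *)
Lemma is_derive_along_field (v : 'rV[R]_m -> 'rV[R]_m) : differentiable v y ->
  differentiable (fun z => 'D_(v z) g z : R^o) y /\
  forall u, 'D_u (fun z => 'D_(v z) g z : R^o) y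
    = 'D_('D_u v y) g y + 'D_u ('D_(v y) g) y.
Proof.
move=> dv; have [dg Dg] := cg.
have nD : \forall z \near y, D z by exact: open_nbhs_nbhs.
have sumE (v' : 'rV[R]_m -> 'rV[R]_m) : \forall z \near y,
    (\sum_l (fun z => v' z 0 l * 'D_(delta_mx 0 l) g z : R^o)) z = 'D_(v' z) g z.
  apply: filterS nD => z Dz; rewrite fct_sumE derive_sum_coord //; exact: dg.
have dgl l : differentiable ('D_(delta_mx 0 l) g) y by exact: (Dg _).1.
have dvl l : differentiable (fun z => v z 0 l : R^o) y.
  exact: ((differentiable_rowP v y).1 dv).
have dprod l : differentiable (fun z => v z 0 l * 'D_(delta_mx 0 l) g z : R^o) y.
  exact: differentiableM.
split; first by apply: near_eq_differentiable (sumE v) _; exact: differentiable_sum.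
move=> u; rewrite -(near_eq_derive _ (sumE v)).
rewrite -(near_eq_derive _ (sumE (fun=> v y))).
rewrite !derive_sum => [|l|l]; last first.
- exact/diff_derivable/dprod.
- by apply/diff_derivable; apply: differentiableM => //; exact: differentiable_cst.
rewrite derive_sum_coord; last exact: dg.
rewrite -big_split /=; apply: eq_bigr => l _.
rewrite (@deriveM _ _ (fun z => v z 0 l)); [|exact/diff_derivable|exact/diff_derivable].
rewrite (@deriveM _ _ (fun=> v y 0 l)); [|exact: derivable_cst|exact/diff_derivable].
rewrite derive_cst scaler0 addr0 addrC; congr (_ + _).
rewrite -derive_coord; last exact/diff_derivable.
by rewrite [LHS]mulrC.
Qed.

(** The bracket of [v] and [b u] acting on a function [g]: the second derivatives of [g] cancel by
    symmetry, and the direction left over is the bracket. *)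
Lemma bracket_coord (v : 'rV[R]_m -> 'rV[R]_m) (b : 'rV[R]_m -> R^o) u :
  differentiable v y -> differentiable b y ->
  'D_(v y) (fun z => b z * 'D_u g z : R^o) y
    - 'D_(b y *: u) (fun z => 'D_(v z) g z : R^o) y
  = 'D_('D_(v y) b y *: u - b y *: 'D_u v y) g y.
Proof.
move=> dv db; have [dg Dg] := cg; have [df dE] := is_derive_along_field dv.
rewrite (@deriveM _ _ b); [|exact/diff_derivable|by apply/diff_derivable; exact: (Dg u).1].
rewrite (deriveE _ df) linearZ /= -deriveE // dE.
rewrite (derive_sym u (v y) oD Dy cg).
have dgy := dg y Dy.
have -> : 'D_('D_(v y) b y *: u - b y *: 'D_u v y) g y =
    'D_(v y) b y * 'D_u g y - b y * 'D_('D_u v y) g y.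
  by rewrite deriveE // linearB !linearZ /= -!(deriveE _ dgy).
move: ('D_u g y) ('D_(v y) b y) ('D_('D_u v y) g y) ('D_u ('D_(v y) g) y).
by move=> A B C E; rewrite /GRing.scale /=; ring.
Qed.

End derivative_along_field.

Section bump_section.
Context {R : realType} {n : nat} (U : smooth_manifold R n).
Local Notation phi := (@mphi R n U).

(** The bump is [exp (- 1 / q2)] where [q2 > 0]. It is built on the squared Euclidean distance,
    which is smooth, unlike the maximum norm of row vectors; the Euclidean ball lies in the
    maximum-norm ball [B], whose image under the inverse chart is the compact set [K]. *)
Lemma chart_bump i (p : U) (G : set U) : mdom i p -> open G -> G p ->
  exists (b : 'rV[R]_n -> R^o) (K : set U), [/\ forall r, Ck r setT b,
    b (phi i p) != 0, compact K, K `<=` mdom i `&` G &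
    forall q, mdom i q -> b (phi i q) != 0 -> K q].
Proof.
move=> dp oG Gp; set x0 := phi i p.
have : nbhs x0 (phi i @` (mdom i `&` G)).
  by apply: open_nbhs_nbhs; split; [exact: open_chart_image|exists p].
move=> /nbhs_ballP[r0 r00 hr0].
(* Half the radius, so that the closed ball still lies in the image of the chart. *)
pose r := r0 / 2; have r0' : 0 < r by rewrite divr_gt0.
pose B := [set x : 'rV[R]_n | `|x - x0| <= r].
have Bsub : B `<=` phi i @` (mdom i `&` G).
  move=> x Bx; apply: hr0; rewrite -ball_normE /= distrC (le_lt_trans Bx) //.
  by rewrite /r ltr_pdivrMr // ltr_pMr // ltr1n.
pose q2 (x : 'rV[R]_n) : R^o := r ^+ 2 - \sum_l (x 0 l - x0 0 l) ^+ 2.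
exists (fun x => flat_exp 0 (q2 x)), (@mpsi _ _ U i @` B); split.
- move=> k; apply: Ck_flat_exp; first exact: openT.
  move=> k'; rewrite /q2.
  have cc l : Ck k' setT (fun x : 'rV[R]_n => x 0 l - x0 0 l : R^o).
    by apply: Ck_add; [exact: openT|exact: Ck_coord|exact: (Ck_cst _ _ (- x0 0 l : R^o))].
  have cs : Ck k' setT (fun x : 'rV[R]_n => \sum_l (x 0 l - x0 0 l) * (x 0 l - x0 0 l) : R^o).
    by apply: Ck_sum; [exact: openT|move=> l; apply: Ck_mul => //; exact: openT].
  apply: (@eq_Ck _ _ _ _ _ (fun x => r ^+ 2 + (- 1) *
    (\sum_l (x 0 l - x0 0 l) * (x 0 l - x0 0 l)) : R^o)); first exact: openT.
    by move=> x _; rewrite mulN1r; congr (_ - _); apply: eq_bigr => l _; rewrite expr2.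
  apply: Ck_add; [exact: openT|exact: (Ck_cst _ _ (r ^+ 2 : R^o))|].
  by apply: Ck_mul; [exact: openT|exact: (Ck_cst _ _ (- 1 : R^o))|].
- rewrite /q2 /flat_exp big1 ?subr0 => [|l _]; last by rewrite subrr expr0n.
  by rewrite exprn_gt0 // expr0 mul1r gt_eqF // expR_gt0.
- apply: continuous_compact.
    apply: continuous_in_subspaceT => x; rewrite inE => /Bsub[q [dq _] <-].
    by apply: mpsi_continuous; exists q.
  have -> : B = closed_ball_ Num.norm x0 r.
    by apply/funext => z; rewrite /B /closed_ball_ /= distrC.
  apply: bounded_closed_compact; last exact: closed_closed_ball_.
  exists (`|x0| + r); split; first exact: num_real.
  move=> M HM x /=; rewrite /closed_ball_ /= => xB; apply: le_trans (ltW HM).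
  rewrite -[x](subrK x0) addrC (le_trans (ler_normD _ _)) // lerD2l distrC //.
- by move=> _ [x /Bsub[q [dq Gq] <-] <-]; rewrite mphiK.
- move=> q dq; rewrite /flat_exp; case: ifP => [q0 _|_]; last by rewrite eqxx.
  exists (phi i q); last by rewrite mphiK.
  apply/rV_norm_leP; first exact: ltW.
  move=> l; rewrite !mxE.
  have : (phi i q 0 l - x0 0 l) ^+ 2 <= r ^+ 2.
    move: q0; rewrite /q2 subr_gt0 => /ltW; apply: le_trans.
    by rewrite (bigD1 l) //= lerDl; apply: sumr_ge0 => j _; exact: sqr_ge0.
  by rewrite -[leLHS]real_normK ?num_real // ler_pXn2r ?nnegrE ?(ltW r0').
Qed.

Variables (m k : nat) (M O : set U) (psi : U -> 'rV[R]_m) (s : 'rV[R]_m -> U).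
Variable (N : U -> set (tvec U)).
Hypothesis hO : submfd_chart M O psi s.
Hypothesis hN : forall p, O p -> N p = dparam s (psi p) @`
  [set w : 'rV[R]_m | forall j : 'I_m, (k <= j)%N -> w 0 j = 0].
Hypothesis N0 : forall p, M p -> N p 0.

Lemma tangent0 (p : U) : tangent p 0.
Proof.
move=> i dp; apply/funext => j.
have [dj|dj] := pselect (mdom j (mpsi i (phi i p))).
  by rewrite dparam_dom // derive0.
by rewrite dparam_ndom.
Qed.

Lemma tangent_dparam p w : O p -> tangent p (dparam s (psi p) w).
Proof.
move=> Op i dp; have [_ _ sK _ _] := hO; apply/funext => j.
have [dj|dj] := pselect (mdom j p); last first.
  by rewrite dparam_ndom ?sK // [RHS]dparam_ndom // mphiK.
rewrite dparam_dom ?sK // [X in _ = X]dparam_dom ?mphiK //.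
rewrite dparam_dom ?sK //.
have Qp := param_domP hO Op dp.
have dsig := differentiable_param hO Qp.
have Tp : (phi i @` (mdom i `&` mdom j)) (phi i p) by exists p.
have dT : differentiable (phi j \o mpsi i) (phi i p) by exact: (mtransition i j 1%N).1.
have E : phi i p = (phi i \o s) (psi p) by rewrite /= sK.
rewrite {1}E -derive_comp; [|exact: dsig|by rewrite -E].
apply: near_eq_derive.
have := near_param hO Op dp (@mimg_open _ _ U i) (ex_intro2 _ _ p dp erefl).
by apply: filterS => z [[_ dz] _]; rewrite /= mphiK.
Qed.

Variables (a : 'I_m) (ak : (a < k)%N) (i : mchart U) (b : 'rV[R]_n -> R^o) (K : set U).
Hypotheses (cb : forall r, Ck r setT b) (cK : closed K) (KM : K `&` M `<=` O)
  (Ki : K `<=` mdom i) (bK : forall q, mdom i q -> b (phi i q) != 0 -> K q).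

Definition bump_at (q : U) : R := if `[< mdom i q >] then b (phi i q) else 0.

Definition bump_field (q : U) : tvec U :=
  if `[< O q >] then bump_at q *: dparam s (psi q) (delta_mx 0 a) else 0.

Lemma bump_field_out q : ~ K q -> bump_field q = 0.
Proof.
move=> nK; rewrite /bump_field /bump_at; case: asboolP => // _.
case: asboolP => [dq|_]; last by rewrite scale0r.
have [->|/(bK dq)//] := eqVneq (b (phi i q)) 0.
by rewrite scale0r.
Qed.

Lemma bump_fieldE q : O q -> bump_field q = dparam s (psi q) (bump_at q *: delta_mx 0 a).
Proof.
move=> Oq; rewrite /bump_field asboolT //; apply/funext => j; rewrite /GRing.scale /=.
have [_ _ sK _ _] := hO.
have [dj|dj] := pselect (mdom j (s (psi q))).
  by rewrite (dparamZ hO) //; exists q.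
by rewrite !dparam_ndom // scaler0.
Qed.

(** Off the closed set [K] the field vanishes locally; a point of [K] in M lies in [O], where the
    parametrization is smooth. The component in chart [j] has to be extended in an arbitrary chart
    [i'], while the bump is given in chart [i]: hence three charts. *)
Lemma bump_field_section : section_of M N bump_field.
Proof.
have [[G oG OE] _ sK _ _] := hO.
split; last first.
  move=> p Mp; have [Op|nO] := pselect (O p); last first.
    by rewrite /bump_field asboolF //; exact: N0.
  rewrite bump_fieldE // hN //; exists (bump_at p *: delta_mx 0 a) => // j kj.
  rewrite !mxE eqxx /=; case: eqP => [ja|]; last by rewrite mulr0.
  by move: kj; rewrite ja leqNgt ak.
split.
  move=> p Mp; have [Op|nO] := pselect (O p); last first.
    by rewrite /bump_field asboolF //; exact: tangent0.
  by rewrite bump_fieldE //; exact: tangent_dparam.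
move=> j p i' [Mp dj] dp.
have [Kp|nK] := pselect (K p); last first.
  exists (cst 0), (phi i' @` (mdom i' `&` ~` K)); split.
  - by apply: open_chart_image; exact: closed_openC.
  - by exists p.
  - by move=> r; exact: Ck_cst.
  - by move=> q [Mq dq] dq' /(chart_imageP _ dq')/bump_field_out ->.
have Op : O p by exact: KM.
have [D [h [oD Dp ch hE]]] := submfd_chart_ext hO Op dp.
have dip := Ki Kp.
pose E := phi i' @` (mdom i' `&` (mdom i `&` G)).
have oE : open E by apply: open_chart_image; apply: openI => //; exact: mdom_open.
pose Q := param_dom O psi s j.
have oQ : open Q by exact: (open_param_dom hO).
pose T := E `&` (D `&` h @^-1` Q).
have oT : open T.
  apply: openI => //; apply: open_setI_preimage => // x Dx.
  exact: (ch 0%N).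
pose u : 'rV[R]_m := delta_mx 0 a.
exists (fun x => b (phi i (mpsi i' x)) *: 'D_u (phi j \o s) (h x)), T; split.
- exact: oT.
- split; first by exists p => //; split=> //; split=> //; move: Op; rewrite OE => -[].
  by split=> //; rewrite /= -hE //; exact: (param_domP hO).
- move=> r; apply/CkP => // l.
  have c1 : Ck r T (fun x => b (phi i (mpsi i' x)) : R^o).
    apply: (@Ck_comp_fct _ _ _ _ _ setT b (phi i \o mpsi i')) => //.
    by apply: sub_Ck (mtransition i' i r) => x [[q [dq [diq _]] <-] _]; exists q.
  have c2 : Ck r T ('D_u (phi j \o s) \o h).
    have chT : Ck r T h by apply: sub_Ck (ch r) => x [_ []].
    apply: (Ck_comp oT oQ _ ((Ck_param hO r.+1 j).2 u) chT) => x [_ []] //.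
  have E1 x : T x -> b (phi i (mpsi i' x)) * ('D_u (phi j \o s) \o h) x 0 l =
     (b (phi i (mpsi i' x)) *: 'D_u (phi j \o s) (h x)) 0 l by rewrite mxE.
  apply: (eq_Ck oT E1); apply: Ck_mul => //.
  exact: ((CkP r _ oT).1 c2 l).
- move=> q [Mq djq] dq' [/(chart_imageP _ dq')[diq Gq] [Dq _]].
  have Oq : O q by rewrite OE.
  rewrite /bump_field asboolT // /bump_at asboolT // mphiK // -hE //.
  by rewrite /GRing.scale /= dparam_dom ?sK.
Qed.

End bump_section.

Section transverse_velocity.
Context {R : realType} {n : nat} (U : smooth_manifold R n).
Local Notation phi := (@mphi R n U).
Variables (m k : nat) (M O : set U) (psi : U -> 'rV[R]_m) (s : 'rV[R]_m -> U).
Variables (N : U -> set (tvec U)) (V : U -> tvec U).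
Hypothesis hO : submfd_chart M O psi s.
Hypothesis hN : forall p, O p -> N p = dparam s (psi p) @`
  [set w : 'rV[R]_m | forall j : 'I_m, (k <= j)%N -> w 0 j = 0].
Hypothesis N0 : forall p, M p -> N p 0.
Hypothesis hV : vfield_on (Some 2%N) setT V.
Hypothesis hVF : forall W, section_of M N W -> forall p, M p ->
  N p (lie_bracket M V W p).

(* The bracket with [W = b d_a], for a bump function [b] around [p], equals
   [(d b)(v) d_a - b (d_a v)] in the flat chart. *)
Lemma transverse_velocity_const (v : 'rV[R]_m -> 'rV[R]_m) p (a j : 'I_m) :
  O p -> (a < k)%N -> (k <= j)%N -> differentiable v (psi p) ->
  (\forall z \near psi p, V (s z) (chart_at p) = dparam s z (v z) (chart_at p)) ->
  'D_(delta_mx 0 a) (fun z => v z 0 j : R^o) (psi p) = 0.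
Proof.
move=> Op ak kj dv; set i := chart_at p => nV.
have dp : mdom i p by exact: mdom_cover.
have Mp : M p := submfd_chart_sub hO Op.
have [[G oG OE] _ sK _ _] := hO.
have Gp : G p by move: Op; rewrite OE => -[].
have [b [K [cb b0 kK KG bK]]] := chart_bump dp oG Gp.
have cK : closed K by apply: compact_closed kK; exact: mf_hausdorff.
have KM : K `&` M `<=` O by move=> q [/KG[_ Gq] Mq]; rewrite OE.
have Ki : K `<=` mdom i by move=> q /KG[].
pose W := bump_field O psi s a i b.
have sec := bump_field_section hO hN N0 ak cb cK KM Ki bK.
set y := psi p in dv nV *; set e : 'rV[R]_m := delta_mx 0 a.
pose sig := phi i \o s; pose D := param_dom O psi s i.
have oD : open D by exact: (open_param_dom hO).
have Dy : D y by exact: (param_domP hO).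
have csig r : Ck r D sig := Ck_param hO r i.
have nD : \forall z \near y, D z by exact: open_nbhs_nbhs.
have sy : sig y = phi i p by rewrite /sig /= sK.
have dsig z : D z -> differentiable sig z by exact: (csig 1%N).1.
have dpsy : mdom i (s y) by rewrite sK.
pose B z := b (sig z).
have dB : differentiable B y.
  by apply: (@differentiable_comp _ _ _ _ sig b); [exact: dsig|exact: (cb 1%N).1].
have nVs : \forall z \near y, V (s z) i = 'D_(v z) sig z.
  by apply: filterS2 nD nV => z [_ dz] ->; rewrite dparam_dom.
have WE z : D z -> W (s z) i = B z *: 'D_e sig z.
  move=> [Qz dz]; have Oz := submfd_chart_param hO Qz.
  rewrite /W /bump_field asboolT // /bump_at asboolT // (submfd_chart_paramK hO Qz).
  by rewrite /GRing.scale /= dparam_dom.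
have exW : exists h, local_ext (Some 1%N) M (fun q => W q i) i p h.
  have [h ex] := sec.1.2 i p i (conj Mp dp) dp.
  by exists h; apply: (local_ext_le (r := None) (A := M `&` mdom i)) ex => // E g; exact.
have exV : exists h, local_ext (Some 1%N) M (fun q => V q i) i p h.
  have [h ex] := hV.2 i p i (conj I dp) dp.
  exists h; apply: (local_ext_le (r := Some 2%N) (A := setT `&` mdom i)) ex => // E g.
  exact: Cr_SomeW.
have Vp : V p i = 'D_(v y) sig y by have := nbhs_singleton nVs; rewrite sK.
have Wp : W p i = 'D_(B y *: e) sig y.
  have := WE y Dy; rewrite sK // => ->.
  by rewrite !deriveE ?linearZ //; exact: dsig.
have [w' w'0 brE] : exists2 w' : 'rV[R]_m, (forall l : 'I_m, (k <= l)%N -> w' 0 l = 0) &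
    dparam s y w' = lie_bracket M V W p.
  by have := hVF sec Mp; rewrite hN // => -[w' ? ?]; exists w'.
have {}brE : 'D_w' sig y = 'D_(v y) (fun z => W (s z) i) y
    - 'D_(B y *: e) (fun z => V (s z) i) y.
  have := congr1 (fun f => f i) brE; rewrite dparam_dom // => ->.
  rewrite /lie_bracket asboolT //.
  by congr (_ - _); [exact: (diff_on_param hO Op exW Vp)|exact: (diff_on_param hO Op exV Wp)].
pose w := 'D_(v y) B y *: e - B y *: 'D_e v y.
pose sc c z : R^o := sig z 0 c.
have csc c r : Ck r D (sc c) by exact: ((CkP r sig oD).1 (csig r)).
have scE c u z : D z -> 'D_u (sc c) z = 'D_u sig z 0 c.
  by move=> Dz; rewrite derive_coord //; apply/diff_derivable/dsig.
have nW c : \forall z \near y, B z * 'D_e (sc c) z = W (s z) i 0 c.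
  by apply: filterS nD => z Dz; rewrite WE // scE // mxE.
have nV' c : \forall z \near y, 'D_(v z) (sc c) z = V (s z) i 0 c.
  by apply: filterS2 nD nVs => z Dz ->; rewrite scE.
have dW : differentiable (fun z => W (s z) i) y.
  apply/differentiable_rowP => c; apply: near_eq_differentiable (nW c) _.
  by apply: differentiableM => //; exact: ((csc c 2%N).2 e).1.
have dVs : differentiable (fun z => V (s z) i) y.
  apply/differentiable_rowP => c; apply: near_eq_differentiable (nV' c) _.
  by have [] := is_derive_along_field oD Dy (csc c 2%N) dv.
have ww : 'D_w' sig y = 'D_w sig y.
  apply/rowP => c; rewrite brE [LHS]mxE [X in _ + X]mxE.
  rewrite -(derive_coord c (diff_derivable dW)) -(derive_coord c (diff_derivable dVs)).
  rewrite -(near_eq_derive _ (nW c)) -(near_eq_derive _ (nV' c)).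
  by rewrite (bracket_coord oD Dy (csc c 2%N) e dv dB) scE.
have [T [h [oT Tp ch hE]]] := submfd_chart_ext hO Op dp.
(* Both directions have the same image under the differential of [sig], which is injective by
   [chart_param_id]. *)
have w'w : w' = w.
  rewrite -(chart_param_id hO w' Op dp oT Tp (ch 1%N) hE).
  rewrite -(chart_param_id hO w Op dp oT Tp (ch 1%N) hE).
  by rewrite -/y -/sig ww.
(* The transverse component [j] of [e] is 0 since [a < k <= j]; so the product of [B y] with the
   sought derivative vanishes, and [B y] is nonzero. *)
have := w'0 j kj; rewrite w'w /w !mxE eqxx /=.
have -> : (j == a) = false by apply/eqP => ja; move: kj; rewrite ja leqNgt ak.
rewrite mulr0 sub0r => /eqP; rewrite oppr_eq0 mulf_eq0.
rewrite derive_coord; last exact/diff_derivable.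
by rewrite /B sy (negbTE b0) /= => /eqP.
Qed.

End transverse_velocity.

(** * Lifting plaques along the flow *)

Section flow_box.
Context {R : realType} {n : nat} (U : smooth_manifold R n).
Local Notation phi := (@mphi R n U).
Variables (m k : nat) (M O : set U) (psi : U -> 'rV[R]_m) (s : 'rV[R]_m -> U).
Variables (N : U -> set (tvec U)) (V : U -> tvec U) (X : R -> U -> U).
Hypothesis hO : submfd_chart M O psi s.
Hypothesis hN : forall p, O p -> N p = dparam s (psi p) @`
  [set w : 'rV[R]_m | forall j : 'I_m, (k <= j)%N -> w 0 j = 0].
Hypothesis N0 : forall p, M p -> N p 0.
Hypothesis hV : vfield_on (Some 2%N) setT V.
Hypothesis hVF : forall W, section_of M N W -> forall p, M p ->
  N p (lie_bracket M V W p).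
Hypotheses (hsol : solution_family M V X) (hX : continuous_semiflow M X).

(** [psi] is controlled only on [O]; the neighbourhood in U comes from a local extension of [psi],
    which is continuous. *)
Lemma submfd_chart_near p (D : set 'rV[R]_m) : O p -> nbhs (psi p) D ->
  exists G : set U, [/\ open G, G p & forall q, M q -> G q -> O q /\ D (psi q)].
Proof.
move=> Op nD; have [[G oG OE] _ _ _ _] := hO.
have dp : mdom (chart_at p) p by exact: mdom_cover.
have [T [h [oT Tp ch hE]]] := submfd_chart_ext hO Op dp.
have nG : nbhs p (G `&` (mdom (chart_at p) `&`
    (phi (chart_at p) @^-1` (T `&` h @^-1` D)))).
  apply: filterI; first by apply: open_nbhs_nbhs; split=> //; move: Op; rewrite OE => -[].
  apply: filterI; first by apply: open_nbhs_nbhs; split=> //; exact: mdom_open.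
  apply: (mphi_continuous dp); apply: filterI; first exact: open_nbhs_nbhs.
  by apply: (ch 0%N _ Tp); rewrite -hE.
move: nG; rewrite nbhsE => -[G' [oG' G'p] G'sub]; exists G'; split=> // q Mq.
move=> /G'sub[Gq [dq [Tq hq]]]; have Oq : O q by rewrite OE.
by split=> //; rewrite hE.
Qed.

Lemma local_velocity p : O p -> exists (r L : R) (v : 'rV[R]_m -> 'rV[R]_m),
  [/\ 0 < r, 0 <= L & ball (psi p) r `<=` psi @` O] /\
  [/\ forall z j, ball (psi p) r z -> differentiable (fun z => v z 0 j : R^o) z,
    forall z j l, ball (psi p) r z ->
      `|'D_(delta_mx 0 l) (fun z => v z 0 j : R^o) z| <= L,
    forall z (j l : 'I_m), ball (psi p) r z -> (k <= j)%N -> ~~ (k <= l)%N ->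
      'D_(delta_mx 0 l) (fun z => v z 0 j : R^o) z = 0 &
    forall x t, M x -> 0 <= t -> O (X t x) -> ball (psi p) r (psi (X t x)) ->
      has_velocity (fun u => psi (X u x)) t (v (psi (X t x)))].
Proof.
move=> Op; have [Q [v [oQ Qp QO cv vel]]] := chart_velocity hO hV hsol hX Op.
pose vj j (z : 'rV[R]_m) : R^o := v z 0 j.
have cvj j : Ck 1 Q (vj j) by exact: ((CkP 1 v oQ).1 cv j).
pose c j l := `|'D_(delta_mx 0 l) (vj j) (psi p)|.
(* The derivatives at the centre, summed; the extra 1 leaves room for their variation in a small
   ball. *)
pose L := \sum_j \sum_l c j l + 1.
have S0 j : 0 <= \sum_l c j l by apply: sumr_ge0 => l _; exact: normr_ge0.
have cL j l : c j l + 1 <= L.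
  rewrite lerD2r (bigD1 j) //= ler_wpDr //; first by apply: sumr_ge0.
  by rewrite (bigD1 l) //= lerDl; apply: sumr_ge0 => ? _; exact: normr_ge0.
have L0 : 0 <= L by rewrite addr_ge0 // sumr_ge0.
have nLjl j l : \forall z \near psi p, `|'D_(delta_mx 0 l) (vj j) z| <= L.
  have cjl : {for psi p, continuous ('D_(delta_mx 0 l) (vj j))} by exact: (cvj j).2.
  move/cvgrPdist_lt: cjl => /(_ 1 ltr01); apply: filterS => z zlt.
  apply: le_trans (cL j l); rewrite addrC -lerBlDr.
  by rewrite (le_trans _ (ltW zlt)) // distrC; exact: lerB_dist.
have nL : \forall z \near psi p, forall j l, `|'D_(delta_mx 0 l) (vj j) z| <= L.
  have nLj j : \forall z \near psi p, forall l : 'I_m, `|'D_(delta_mx 0 l) (vj j) z| <= L.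
    exact: (@filter_forall _ 'I_m _ (nbhs (psi p)) _ (nLjl j)).
  exact: (@filter_forall _ 'I_m _ (nbhs (psi p)) _ nLj).
have nQ : \forall z \near psi p, Q z by exact: open_nbhs_nbhs.
have /(nbhs_ballP (psi p) _).1[r r0 rb] : nbhs (psi p) (Q `&`
    [set z | forall j l, `|'D_(delta_mx 0 l) (vj j) z| <= L]) by exact: filterI.
have rQ z : ball (psi p) r z -> Q z by move=> /rb[].
exists r, L, v; split; first by split=> // z /rQ/QO.
split.
- by move=> z j /rQ; exact: (cvj j).1.
- by move=> z j l /rb[_]; exact.
- move=> z j l /rQ Qz kj kl.
  have Oz : O (s z) by apply: (submfd_chart_param hO); exact: QO.
  have pz : psi (s z) = z by apply: (submfd_chart_paramK hO); exact: QO.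
  rewrite -ltnNge in kl.
  have := @transverse_velocity_const _ _ _ _ _ _ _ _ _ _ _ hO hN N0 hV hVF v (s z) l j Oz kl kj.
  rewrite pz; apply; first by apply/differentiable_rowP => j'; exact: (cvj j').1.
  have dz : mdom (chart_at (s z)) (s z) by exact: mdom_cover.
  have nz : \forall z' \near z, param_dom O psi s (chart_at (s z)) z'.
    apply: open_nbhs_nbhs; split; first exact: (open_param_dom hO).
    by split=> //; exact: QO.
  have nQz : \forall z' \near z, Q z' by exact: open_nbhs_nbhs.
  apply: filterS2 nz nQz => z' [Qz' dz'] Qz2.
  have Oz' := submfd_chart_param hO Qz'; have pz' := submfd_chart_paramK hO Qz'.
  have Mz' := submfd_chart_sub hO Oz'; have [_ X0 _ _] := hX.
  apply: (velocity_param hO hsol hX Qz' dz').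
  have := vel (s z') 0 Mz' (lexx 0); rewrite X0 // pz'; exact.
- by move=> x t Mx t0 Ox /rQ; exact: vel.
Qed.

(** Two uses of [flow_comparison]. With all coordinates, the time-[t] map in the chart is a
    perturbation of the identity, so each [y] near [X t x] has a preimage. With the transverse
    coordinates, this preimage is on the plaque of [x] if [y] is on that of [X t x]. *)
Lemma plaque_lift p : O p -> exists (G : set U) (tau : R), [/\ open G, G p, 0 < tau &
  forall x t, M x -> G x -> 0 <= t <= tau -> [/\ O x, O (X t x) &
    exists2 rho : R, 0 < rho & forall y, O y ->
      `|psi y - psi (X t x)| <= rho ->
      (forall j : 'I_m, (k <= j)%N -> psi y 0 j = psi (X t x) 0 j) ->
      exists x', [/\ O x', forall j : 'I_m, (k <= j)%N -> psi x' 0 j = psi x 0 j &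
        X t x' = y]]].
Proof.
move=> Op; have [r [L [v [[r0 L0 rO] [dv vL vP vel]]]]] := local_velocity Op.
have [_ _ sK _ [cs _]] := hO; have [XM X0 _ cX] := hX.
have Mp : M p := submfd_chart_sub hO Op.
have nb : nbhs (psi p) (ball (psi p) r) by exact: nbhsx_ballx.
have [G0 [oG0 G0p G0O]] := submfd_chart_near Op nb.
have [H [d [oH Hp d0 Hd]]] : exists (H : set U) (d : R), [/\ open H, H p, 0 < d &
    forall t x, 0 <= t <= d -> M x -> H x -> G0 (X t x)].
  have nG : nbhs (X 0 p) G0 by rewrite X0 //; exact: open_nbhs_nbhs.
  have := (subspace_continuousP _ _).1 cX (0, p) (conj (lexx 0) Mp) G0 nG.
  move=> [[A B] /= [/nbhs_ballP[e e0 eA] nB] AB].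
  move: nB; rewrite nbhsE => -[H [oH Hp] HB].
  exists H, (e / 2); split=> //; first by rewrite divr_gt0.
  move=> t x /andP[t0 te] Mx Hx; apply: (AB (t, x)) => //=; split; last exact: HB.
  apply: eA; rewrite -ball_normE /= sub0r normrN ger0_norm // (le_lt_trans te) //.
  by rewrite ltr_pdivrMr // ltr_pMr // ltr1n.
have Qp : (psi @` O) (psi p) by exists p.
(* Starting points will be taken within [r1] of [psi x], itself within [r1] of [psi p]. *)
have [r1 r10 r1H] : exists2 r1 : R, 0 < r1 & forall z, `|z - psi p| < r1 + r1 ->
    (psi @` O) z /\ H (s z).
  have [_ oQ _ _ _] := hO.
  have : nbhs (psi p) ((psi @` O) `&` s @^-1` H).
    apply: filterI; first exact: open_nbhs_nbhs.
    by apply: (cs _ Qp); rewrite sK //; exact: open_nbhs_nbhs.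
  move=> /nbhs_ballP[e e0 eH]; exists (e / 2); first by rewrite divr_gt0.
  by move=> z; rewrite -splitr => ze; apply: eH; rewrite -ball_normE /= distrC.
have nb1 : nbhs (psi p) (ball (psi p) r1) by exact: nbhsx_ballx.
have [G1 [oG1 G1p G1O]] := submfd_chart_near Op nb1.
have mL0 : 0 < m%:R * L + 1 by rewrite ltr_wpDl // mulr_ge0.
(* [d] keeps the flow lines in the chart ball; the other bound gives [m L tau <= 1/4], the summand 1
   keeping it positive when [L = 0]. *)
pose tau := Num.min d ((m%:R * L + 1)^-1 / 4).
have tau0 : 0 < tau by rewrite lt_min d0 divr_gt0 // invr_gt0.
have taud : tau <= d by rewrite ge_min lexx.
have tauL : m%:R * L * tau <= 4^-1.
  have : tau <= (m%:R * L + 1)^-1 / 4 by rewrite ge_min lexx orbT.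
  move=> /(ler_wpM2l (mulr_ge0 (ler0n _ _) L0))/le_trans; apply.
  rewrite mulrA -[leRHS]mul1r ler_wpM2r // ?invr_ge0 //.
  by rewrite ler_pdivrMr // mul1r lerDl.
exists G1, tau; split=> // x t Mx Gx tt.
have [Ox xb] := G1O x Mx Gx.
pose c z u := psi (X u (s z)).
have flow z u : `|z - psi p| < r1 + r1 -> 0 <= u <= tau ->
    [/\ O (X u (s z)), ball (psi p) r (c z u) & has_velocity (c z) u (v (c z u))].
  move=> zr /andP[u0 ut]; have [Qz Hz] := r1H z zr.
  have Mz : M (s z) by apply: (submfd_chart_sub hO); exact: (submfd_chart_param hO).
  have GX : G0 (X u (s z)) by apply: Hd => //; rewrite u0 (le_trans ut).
  have [OX bX] := G0O _ (XM _ _ u0 Mz) GX.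
  by split=> //; exact: vel.
have c0 z : `|z - psi p| < r1 + r1 -> c z 0 = z.
  move=> zr; have [Qz Hz] := r1H z zr.
  have Mz : M (s z) by apply: (submfd_chart_sub hO); exact: (submfd_chart_param hO).
  by rewrite /c X0 // (submfd_chart_paramK hO).
have near z : `|z - psi x| <= r1 -> `|z - psi p| < r1 + r1.
  move=> zr; rewrite -(subrKA (psi x)) (le_lt_trans (ler_normD _ _)) // ler_ltD //.
  by move: xb; rewrite -ball_normE /= distrC.
have nx : `|psi x - psi p| < r1 + r1 by apply: near; rewrite subrr normr0 ltW.
have cx : c (psi x) t = psi (X t x) by rewrite /c sK.
have [OXx _ _] := flow (psi x) t nx tt; rewrite sK // in OXx.
split=> //; exists (r1 / 2); first by rewrite divr_gt0.
move=> y Oy yr yP.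
have lip z z' : `|z - psi x| <= r1 -> `|z' - psi x| <= r1 ->
    `|(c z t - c z' t) - (z - z')| <= 2^-1 * `|z - z'|.
  move=> /near hz /near hz'; apply/rV_norm_leP; first by rewrite mulr_ge0 ?invr_ge0.
  move=> j; rewrite !mxE mulrC.
  (* With [predT] no direction is transverse to a plaque or along it, and the constancy assumption
     is vacuous. *)
  have := @flow_comparison _ _ v (psi p) r L tau predT L0 tauL dv vL
    (fun z j l _ _ F => ltac:(discriminate F)) (c z) (c z') (`|z - z'|) t.
  rewrite !c0 //; apply=> //.
  + by move=> u ut; have [] := flow z u hz ut.
  + by move=> u ut; have [] := flow z' u hz' ut.
  + by move=> l _; have := coord_le_norm (z - z') l; rewrite !mxE.
rewrite -cx in yr.
have [z zr cz] := perturbed_identity_onto (ltW r10) lip yr.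
have hz := near z zr; have [Qz Hz] := r1H z hz.
have Oz := submfd_chart_param hO Qz.
exists (s z); split=> //.
- have [OXz _ _] := flow z t hz tt.
  (* The transverse distance at time 0. As it is 0 at time [t] by [yP], all of it is change, whence
     [E <= E / 2]. *)
  pose E := \big[Num.max/0]_(j < m | (k <= j)%N) `|z 0 j - psi x 0 j|.
  have E0 : 0 <= E by exact: bigmax_ge_id.
  have leE (j : 'I_m) : (k <= j)%N -> `|z 0 j - psi x 0 j| <= E.
    by move=> kj; exact: (le_bigmax_cond _ (fun j : 'I_m => `|z 0 j - psi x 0 j|)).
  have EE : E <= E / 2.
    apply: bigmax_le => [|j kj]; first by rewrite divr_ge0.
    have := @flow_comparison _ _ v (psi p) r L tau (fun j : 'I_m => (k <= j)%N) L0 tauL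
      dv vL vP (c z) (c (psi x)) E t.
    rewrite !c0 // cz cx => H1.
    have := H1 _ _ leE tt j kj; rewrite yP // subrr sub0r normrN; apply.
    + by move=> u ut; have [] := flow z u hz ut.
    + by move=> u ut; have [] := flow (psi x) u nx ut.
  have E00 : E = 0 by lra.
  move=> j kj; rewrite (submfd_chart_paramK hO Qz).
  by apply/eqP; rewrite -subr_eq0 -normr_le0 -E00; exact: leE.
- have [OXz _ _] := flow z t hz tt.
  by rewrite -(sK _ OXz) -/(c z t) cz sK.
Qed.

End flow_box.

(** * Leaves *)

(** If the endpoint values differed, the intermediate value theorem would put an interval of
    positive Lebesgue measure into the countable set [C]. *)
Lemma countable_range_const {R : realType} (f : R -> R) (C : set R) : countable C ->
  {within `[0, 1], continuous f} -> (forall t, 0 <= t <= 1 -> C (f t)) -> f 0 = f 1.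
Proof.
move=> cC cf Cf; apply: contrapT => /eqP ne.
pose a := Num.min (f 0) (f 1); pose b := Num.max (f 0) (f 1).
have ab : a < b by rewrite /a /b; have [h|h|h] := ltgtP (f 0) (f 1); rewrite // h eqxx in ne.
have sub : `[a, b]%classic `<=` C.
  move=> v /=; rewrite in_itv /= => vab.
  have [t] := IVT ler01 cf vab; rewrite in_itv /= => t01 <-.
  exact: Cf.
have cI : countable `[a, b]%classic by apply: sub_countable cC; exact: subset_card_le.
have := countable_lebesgue_measure0 cI.
rewrite lebesgue_measure_itv /= lte_fin ab => /eqP.
by rewrite -EFinB eqe subr_eq0 gt_eqF.
Qed.

Section leaves.
Context {R : realType} {n : nat} (U : smooth_manifold R n).
Local Notation phi := (@mphi R n U).
Variables (m k : nat) (M : set U) (N : U -> set (tvec U)) (F : set (set U)).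
Hypothesis hF : foliation_of m k M N F.
Hypothesis hFemb : forall L, F L -> embedded_submfd m k M L.
Hypothesis hFcpt : forall L, F L -> compact L.
Hypothesis hFhaus : leaf_space_hausdorff M F.

Lemma leaf_sub L : F L -> L `<=` M.
Proof. by have [[<- _ _] _ _] := hF => FL q Lq; exists L. Qed.

Lemma leaf_through q : M q -> exists2 L, F L & L q.
Proof. by have [[<- _ _] _ _] := hF. Qed.

Lemma leaf_eq L L' q : F L -> F L' -> L q -> L' q -> L = L'.
Proof. by have [[_ tF _] _ _] := hF => FL FL' Lq Lq'; apply: tF => //; exists q. Qed.

(* The path runs inside the slice of an adapted chart of the embedded leaf; its
   transverse flat coordinates take countably many values, hence are constant. *)
Lemma embedded_leaf_single_plaque L (y : U) O (psi : U -> 'rV[R]_m) s :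
  F L -> L y -> O y -> flat_chart k M N F O psi s ->
  exists G : set U, [/\ open G, G y & forall q, L q -> G q ->
    O q /\ forall j : 'I_m, (k <= j)%N -> psi q 0 j = psi y 0 j].
Proof.
move=> FL Ly Oy [hO _ _ hL]; have [K cK LO] := hL L FL.
have [ O1 [psi1 [s1 [hO1 Oy1 LO1]]]] := hFemb FL Ly.
have [[G oG OE] _ _ _ _] := hO.
have [_ oQ1 sK1 _ [cs1 _]] := hO1.
have Gy : G y by move: Oy; rewrite OE => -[].
have Qy1 : (psi1 @` O1) (psi1 y) by exists y.
have nb : nbhs (psi1 y) (psi1 @` O1 `&` s1 @^-1` G).
  apply: filterI; first exact: open_nbhs_nbhs.
  by apply: (cs1 _ Qy1); rewrite sK1 //; exact: open_nbhs_nbhs.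
have [r r0 rb] := (nbhs_ballP _ _).1 nb.
have [W [oW Wy HW]] := submfd_chart_near hO1 Oy1 (nbhsx_ballx (psi1 y) r r0).
exists W; split=> // q Lq Wq; have Mq := leaf_sub FL Lq.
have [Oq1 qb] := HW q Mq Wq.
pose z t := psi1 y + t *: (psi1 q - psi1 y).
have zb t : 0 <= t <= 1 -> ball (psi1 y) r (z t).
  by move=> t01; apply: ball_segment => //; exact: ballxx.
have qs : slice k O1 psi1 (psi1 y) q by rewrite -LO1.
have Lz t : 0 <= t <= 1 -> L (s1 (z t)) /\ O (s1 (z t)).
  move=> t01; have [Qz Gz] := rb _ (zb t t01).
  have Oz := submfd_chart_param hO1 Qz.
  have : slice k O1 psi1 (psi1 y) (s1 (z t)).
    split=> // j kj; rewrite (submfd_chart_paramK hO1 Qz) !mxE.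
    by rewrite (qs.2 j kj) subrr mulr0 addr0.
  by rewrite -LO1 => -[Ls _]; split=> //; rewrite OE; split=> //; exact: leaf_sub Ls.
have z0 : z 0 = psi1 y by rewrite /z scale0r addr0.
have z1 : z 1 = psi1 q by rewrite /z scale1r addrC subrK.
have l01 : 0 <= (1 : R) <= 1 by rewrite ler01 lexx.
have l00 : 0 <= (0 : R) <= 1 by rewrite lexx ler01.
have Oq : O q by have [_] := Lz 1 l01; rewrite z1 sK1.
split=> // j kj.
have cf t : 0 <= t <= 1 -> {for t, continuous (fun t => psi (s1 (z t)) 0 j : R)}.
  move=> t01; have [Qz Gz] := rb _ (zb t t01); have [Lzt Ozt] := Lz t t01.
  have cz : {for t, continuous z}.
    apply: cvgD; first exact: cvg_cst.
    by apply: cvgZr_tmp; exact: cvg_id.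
  move=> A nA.
  have nA' : nbhs (psi (s1 (z t))) (fun w : 'rV[R]_m => A (w 0 j)).
    exact: (@coord_continuous _ _ _ 0 j (psi (s1 (z t))) A nA).
  have [H [oH Hz HA]] := submfd_chart_near hO Ozt nA'.
  have n1 : \forall u \near t, (psi1 @` O1 `&` s1 @^-1` H) (z u).
    apply: cz; apply: filterI; first exact: open_nbhs_nbhs.
    by apply: (cs1 _ Qz); exact: open_nbhs_nbhs.
  apply: filterS n1 => u [Qu Hu] /=.
  have Mu : M (s1 (z u)).
    by apply: (submfd_chart_sub hO1); exact: (submfd_chart_param hO1).
  by have [_] := HA _ Mu Hu.
have := @countable_range_const _ (fun t => psi (s1 (z t)) 0 j)
  [set c 0 j | c in K].
rewrite z0 z1 !sK1 // => -> //.
- by apply: sub_countable cK; exact: card_image_le.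
- apply: continuous_in_subspaceT => t; rewrite inE /= in_itv /= => t01.
  exact: cf.
- move=> t /Lz[Lzt Ozt].
  have : (L `&` O) (s1 (z t)) by [].
  by rewrite LO => -[c Kc [_ cE]]; exists c => //; rewrite -cE.
Qed.

Hypothesis cM : closed M.

(* Compactness of the leaf and separation in the leaf space give, around a
   compact neighbourhood of [L], a saturated neighbourhood missing its boundary. *)
Lemma leaf_stability L (G : set U) : F L -> open G -> L `<=` G ->
  exists G' : set U, [/\ open G', L `<=` G' &
    forall L', F L' -> (exists2 q, L' q & G' q) -> L' `<=` G].
Proof.
move=> FL oG LG; have hU := @mf_hausdorff _ _ U.
have /choice[B HB] : forall p : U, exists BK : set U * set U, L p ->
    [/\ open BK.1, BK.1 p, BK.1 `<=` G, BK.1 `<=` BK.2 & compact BK.2].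
  move=> p; have [Lp|nL] := pselect (L p); last by exists (set0, set0).
  have dp : mdom (chart_at p) p by exact: mdom_cover.
  have [b [K [cb b0 kK KG bK]]] := chart_bump dp oG (LG p Lp).
  have cb0 x : {for x, continuous b} by exact: (cb 0%N).
  have ob : open [set x | b x != 0].
    have -> : [set x | b x != 0] = setT `&` b @^-1` [set u | u != 0] by rewrite setTI.
    by apply: (open_setI_preimage openT (@open_neq R 0)) => x _; exact: cb0.
  exists (mdom (chart_at p) `&` phi (chart_at p) @^-1` [set x | b x != 0], K) => _.
  split=> //=; first exact: open_chart_preimage.
  - by move=> q [dq /= bq]; have [] := KG q (bK q dq bq).
  - by move=> q [dq /= bq]; exact: bK.
have [sq Hsq] : exists sq : seq U, forall q, L q -> exists p, [/\ p \in sq, L p & (B p).1 q].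
  by apply: compact_finite_cover; [exact: hFcpt|move=> p /HB[]].
pose Nb : set U := \bigcup_(p in [set p | (p \in sq) && `[< L p >]]) (B p).1.
pose K : set U := \bigcup_(p in [set p | (p \in sq) && `[< L p >]]) (B p).2.
have oN : open Nb by apply: bigcup_open => p /andP[_ /asboolP/HB[]].
have NG : Nb `<=` G.
  by move=> q [p /andP[_ /asboolP/HB[_ _ pG _ _]]]; exact: pG.
have NK : Nb `<=` K.
  move=> q [p pp Bq]; exists p => //; move: pp => /andP[_ /asboolP/HB[_ _ _ pK _]].
  exact: pK.
have LN : L `<=` Nb.
  move=> q /Hsq[p [psq Lp Bq]]; exists p => //=; rewrite psq /=; exact/asboolP.
have kK : compact K.
  rewrite /K bigcup_seq_cond; apply: bigsetU_compact => p /asboolP/HB[] //.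
have cK : closed K by exact: compact_closed.
(* [Z] contains the part of the boundary of [Nb] in M; a leaf that meets [Nb] and avoids [Z] cannot
   get out of [Nb]. *)
pose Z := (K `&` M) `&` ~` Nb.
have kZ : compact Z.
  by apply: compact_closedI; [exact: compact_closedI|exact: open_closedC].
(* A point [z] of [Z] is on a leaf other than [L]. [Q z] stores two open sets of U and the disjoint
   sets of leaves that they cut out, around [L] and around the leaf of [z]. *)
have /choice[Q HQ] : forall z : U, exists Q : (set U * set U) * (set (set U) * set (set U)),
    Z z -> [/\ open Q.1.1, open Q.1.2, Q.2.1 L, Q.1.2 z &
      [/\ \bigcup_(L' in Q.2.1) L' = M `&` Q.1.1,
        \bigcup_(L' in Q.2.2) L' = M `&` Q.1.2, Q.2.1 `<=` F, Q.2.2 `<=` F &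
        Q.2.1 `&` Q.2.2 = set0]].
  move=> z; have [Zz|nZ] := pselect (Z z); last by exists ((set0, set0), (set0, set0)).
  have [[Kz Mz] nNz] := Zz; have [Lz FLz Lzz] := leaf_through Mz.
  have ne : L <> Lz by move=> LLz; apply/nNz/LN; rewrite LLz.
  have [P1 [P2 [[P1F [G1 oG1 E1]] [P2F [G2 oG2 E2]] P1L P2L P12]]] := hFhaus FL FLz ne.
  exists ((G1, G2), (P1, P2)) => _; split=> //=.
  have : (\bigcup_(L' in P2) L') z by exists Lz.
  by rewrite E2 => -[].
have [sz Hsz] : exists sz : seq U, forall q, Z q -> exists z, [/\ z \in sz, Z z & (Q z).1.2 q].
  by apply: compact_finite_cover => // z /HQ[].
pose I := \big[setI/setT]_(z <- sz | `[< Z z >]) (Q z).1.1.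
have oI : open I.
  rewrite /I; elim/big_ind : _ => //; [exact: openT|by move=> *; exact: openI|].
  by move=> z /asboolP/HQ[].
have IE q : I q <-> forall z, z \in sz -> Z z -> (Q z).1.1 q.
  rewrite /I -bigcap_seq_cond; split=> [H z zs Zz|H z /= /andP[zs /asboolP Zz]].
    by apply: H; rewrite /= zs /=; exact/asboolP.
  exact: H.
exists (Nb `&` I); split; first exact: openI.
  move=> q Lq; split; first exact: LN.
  apply/IE => z _ /HQ[_ _ QL _ [QE _ _ _ _]].
  have : (\bigcup_(L' in (Q z).2.1) L') q by exists L.
  by rewrite QE => -[].
move=> L' FL' [q L'q [Nq /IE Iq]]; have M' := leaf_sub FL'.
have nZ w : L' w -> ~ Z w.
  move=> L'w /Hsz[z [zs Zz Qw]]; have [_ _ _ _ [Q1 Q2 F1 F2 Q12]] := HQ z Zz.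
  have : (\bigcup_(L' in (Q z).2.1) L') q.
    by rewrite Q1; split; [exact: M'|exact: Iq].
  move=> [L1 QL1 L1q]; have : (\bigcup_(L' in (Q z).2.2) L') w.
    by rewrite Q2; split; [exact: M'|].
  move=> [L2 QL2 L2w].
  have E1 : L1 = L' by apply: (leaf_eq _ FL' L1q) => //; exact: F1.
  have E2 : L2 = L' by apply: (leaf_eq _ FL' L2w) => //; exact: F2.
  have : ((Q z).2.1 `&` (Q z).2.2) L' by split; [rewrite -E1|rewrite -E2].
  by rewrite Q12.
have [_ conn _] := hF.
(* This trace is open in the leaf by its left-hand form and closed by its right-hand form. *)
have E : L' `&` Nb = L' `&` K.
  apply/seteqP; split=> [w [L'w Nw]|w [L'w Kw]]; first by split=> //; exact: NK.
  split=> //; apply: contrapT => nNw; apply: (nZ w L'w); split=> //.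
  by split=> //; exact: M'.
have <- : L' `&` Nb = L' by apply: conn => //; [exists q|exists Nb|exists K].
by move=> w [_ /NG].
Qed.

End leaves.

(** * Saturation of the attractor *)

Section saturation.
Context {R : realType} {n : nat} (U : smooth_manifold R n).
Variables (m k : nat) (M : set U) (N : U -> set (tvec U)) (F : set (set U)).
Hypothesis hF : foliation_of m k M N F.
Hypothesis hFemb : forall L, F L -> embedded_submfd m k M L.
Hypothesis hFcpt : forall L, F L -> compact L.
Hypothesis hFhaus : leaf_space_hausdorff M F.
Hypothesis cM : closed M.
Variables (V : U -> tvec U) (X : R -> U -> U).
Hypothesis hV : vfield_on (Some 2%N) setT V.
Hypothesis hVF : forall W, section_of M N W -> forall p, M p ->
  N p (lie_bracket M V W p).
Hypotheses (hsol : solution_family M V X) (hX : continuous_semiflow M X).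

Lemma leaf_dist_zero p : M p -> N p 0.
Proof.
move=> Mp; have [_ _ /(_ p Mp)[ O [psi [s [Op [hO _ hN _]]]]]] := hF.
have [_ _ sK _ _] := hO; rewrite hN //; exists 0; first by move=> j _; rewrite mxE.
apply/funext => i; have [d|d] := pselect (mdom i (s (psi p))).
  by rewrite dparam_dom // derive0.
by rewrite dparam_ndom.
Qed.

(** Local surjectivity of [X t] onto the leaf through [X t x]. All times up to [tau] are included so
    that the property passes to smaller [tau] and can be treated as eventually true for [tau]
    tending to 0 from the right. *)
Definition leaf_liftable (tau : R) (x : U) := forall t L L', 0 <= t <= tau ->
  F L -> L x -> F L' -> L' (X t x) -> exists G : set U,
    [/\ open G, G (X t x) & forall y, L' y -> G y -> exists2 x', L x' & X t x' = y].

Lemma leaf_liftableS tau tau' x : tau' <= tau -> leaf_liftable tau x ->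
  leaf_liftable tau' x.
Proof.
by move=> tt H t L L' /andP[t0 tt']; apply: H; rewrite t0 (le_trans tt').
Qed.

(** Passage from plaques to leaves at both ends: near [X t x] its leaf is a single plaque, so
    [plaque_lift] applies, and the preimage is in the leaf of [x] because a leaf contains every
    plaque of the flat chart that it meets. *)
Lemma near_leaf_liftable p : M p -> exists (G : set U) (tau : R),
  [/\ open G, G p, 0 < tau & forall x, M x -> G x -> leaf_liftable tau x].
Proof.
move=> Mp; have [_ _ /(_ p Mp)[ O [psi [s [Op hflat]]]]] := hF.
have [hO _ hN hL] := hflat.
have [G [tau [oG Gp tau0 H]]] := plaque_lift hO hN leaf_dist_zero hV hVF hsol hX Op.
exists G, tau; split=> // x Mx Gx t L L' tt FL Lx FL' L'x.
have [Ox OXx [rho rho0 Hrho]] := H x t Mx Gx tt.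
have [G1 [oG1 G1x G1P]] := embedded_leaf_single_plaque hF hFemb FL' L'x OXx hflat.
have [G2 [oG2 G2x G2P]] := submfd_chart_near hO OXx (nbhsx_ballx (psi (X t x)) rho rho0).
exists (G1 `&` G2); split; [exact: openI|by []|].
move=> y L'y [G1y G2y]; have [Oy yP] := G1P y L'y G1y.
have [_ yb] := G2P y (leaf_sub hF FL' L'y) G2y.
have [|x' [Ox' x'P Xx']] := Hrho y Oy _ yP.
  by rewrite distrC; move: yb; rewrite -ball_normE /= => /ltW.
exists x' => //; have [K _ LO] := hL L FL.
have : (L `&` O) x by [].
rewrite LO => -[c Kc [_ xc]].
have : (\bigcup_(c in K) slice k O psi c) x'.
  by exists c => //; split=> // j kj; rewrite x'P // xc.
by rewrite -LO => -[].
Qed.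

(** The part of [L'] covered by the image of [L] is nonempty, open in [L'] by liftability at the
    points of [L], and closed because the image is compact; and [L'] is connected. *)
Lemma leaf_sub_flow_image L L' tau t x : F L -> F L' -> L x -> L' (X t x) ->
  0 <= t <= tau -> (forall x', L x' -> leaf_liftable tau x') -> L' `<=` X t @` L.
Proof.
move=> FL FL' Lx L'x tt lift; have [XM _ _ cX] := hX.
have t0 : 0 <= t by case/andP: tt.
have [_ conn _] := hF.
have cXt : {within L, continuous (X t)}.
  apply/subspace_continuousP => z Lz A nA.
  have Mz := leaf_sub hF FL Lz.
  have := (subspace_continuousP _ _).1 cX (t, z) (conj t0 Mz) A nA.
  move=> [[A1 A2] /= [nA1 nA2] AP].
  rewrite /= /within /=; apply: filterS nA2 => q A2q Lq.
  apply: (AP (t, q)); first by split=> //=; exact: nbhs_singleton nA1.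
  by split=> //=; exact: (leaf_sub hF FL Lq).
have cI : closed (X t @` L).
  apply: compact_closed; first exact: mf_hausdorff.
  by apply: continuous_compact => //; exact: hFcpt.
have /choice[G HG] : forall y : U, exists G : set U, (L' `&` X t @` L) y ->
    [/\ open G, G y & L' `&` G `<=` X t @` L].
  move=> y; have [[L'y [x' Lx' xy]]|ny] := pselect ((L' `&` X t @` L) y); last by exists set0.
  rewrite -xy in L'y *.
  have [G [oG Gy GP]] := lift x' Lx' t L L' tt FL Lx' FL' L'y.
  by exists G => _; split=> // z [L'z Gz]; have [x2 ? ?] := GP z L'z Gz; exists x2.
have <- : L' `&` X t @` L = L'.
  apply: conn => //; first by exists (X t x); split=> //; exists x.
    exists (\bigcup_(y in L' `&` X t @` L) G y).
      by apply: bigcup_open => y /HG[].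
    apply/seteqP; split=> [y Ey|y [L'y [z Ez Gzy]]].
      by split; [case: Ey|exists y => //; have [] := HG y Ey].
    by split=> //; have [_ _] := HG z Ez; apply.
  by exists (X t @` L).
by move=> y [].
Qed.

Definition saturation (A : set U) : set U :=
  \bigcup_(L in [set L | F L /\ exists2 p, A p & L p]) L.

Lemma saturation_sub A : saturation A `<=` M.
Proof. by move=> q [L [FL _] Lq]; exact: (leaf_sub hF FL Lq). Qed.

(** Makes a locally uniform eventual property uniform on all leaves meeting [A], by compactness used
    twice: a leaf is covered by finitely many [G], stability keeps the leaves near it inside that
    cover, and compactness of [A] combines these stable neighbourhoods. The filter is [+oo] for a
    bound on distances and [0^'+] for a common [tau]. *)
Lemma near_saturation (P : R -> U -> Prop) (Fi : set_system R) (FF : Filter Fi) A :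
  A `<=` M -> compact A ->
  (forall x, M x -> exists G : set U, [/\ open G, G x &
    \forall u \near Fi, forall y, M y -> G y -> P u y]) ->
  \forall u \near Fi, forall q, saturation A q -> P u q.
Proof.
move=> AM cA H.
have H1 L : F L -> exists G : set U, [/\ open G, L `<=` G &
    \forall u \near Fi, forall y, M y -> G y -> P u y].
  move=> FL.
  have /choice[G HG] : forall x, exists G : set U, L x -> [/\ open G, G x &
      \forall u \near Fi, forall y, M y -> G y -> P u y].
    move=> x; have [Lx|nL] := pselect (L x); last by exists set0.
    by have [G HG] := H x (leaf_sub hF FL Lx); exists G.
  have [sq Hsq] : exists sq : seq U, forall q, L q -> exists p, [/\ p \in sq, L p & G p q].
    by apply: compact_finite_cover; [exact: hFcpt|move=> p /HG[]].
  exists (\bigcup_(p in [set p | (p \in sq) && `[< L p >]]) G p); split.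
  - by apply: bigcup_open => p /andP[_ /asboolP/HG[]].
  - by move=> q /Hsq[p [psq Lp Gq]]; exists p => //=; rewrite psq; exact/asboolP.
  - have near_seq (s : seq U) : \forall u \near Fi, forall p, p \in s -> L p ->
        forall y, M y -> G p y -> P u y.
      elim: s => [|x s IH]; first by apply: nearW.
      have [Lx|nLx] := pselect (L x); last first.
        by apply: filterS IH => u Hu p; rewrite inE => /orP[/eqP->//|/Hu].
      have [_ _ Gx] := HG x Lx.
      apply: filterS2 IH Gx => u Hu Gu p; rewrite inE => /orP[/eqP-> _//|/Hu]; exact.
    apply: filterS (near_seq sq) => u Hu y My [p /andP[psq /asboolP Lp]].
    exact: Hu.
have /compact_near_coveringP cA' := cA.
have K : \forall u \near Fi, A `<=` (fun q => M q ->
    forall L', F L' -> L' q -> forall y, L' y -> P u y).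
  apply: cA' => x Ax; have [L FL Lx] := leaf_through hF (AM x Ax).
  have [G [oG LG Hu]] := H1 L FL.
  have [G' [oG' LG' HG']] := leaf_stability hF hFcpt hFhaus cM FL oG LG.
  exists (G', [set u | forall y, M y -> G y -> P u y]).
    by split=> //=; apply: open_nbhs_nbhs; split=> //; exact: LG'.
  move=> [q u] [/= G'q Pu] Mq L' FL' L'q y L'y.
  apply: Pu; first exact: (leaf_sub hF FL' L'y).
  by apply: (HG' L' FL') => //; exists q.
apply: filterS K => u Hu q [L [FL [p Ap Lp]] Lq].
exact: (Hu p Ap (AM p Ap) L FL Lp q Lq).
Qed.

Lemma saturation_bounded (d : U -> U -> R) A : distance_on M d ->
  A `<=` M -> compact A -> bounded_in d (saturation A).
Proof.
move=> hd AM cA; have [[p0 Ap0]|nA] := pselect (exists p, A p); last first.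
  by exists 0 => p q [L [_ [p' Ap' _]]]; case: nA; exists p'.
have Mp0 := AM p0 Ap0; have [_ sym tri _] := hd.
have [|C [_ HC]] := @near_saturation (fun C y => d p0 y <= C) +oo _ A AM cA.
  move=> x Mx; have [G [oG Gx] GM] := distance_nbhs hd Mx (@ltr01 R).
  exists G; split=> //.
  have nC : \forall C \near +oo, d p0 x + 1 <= C.
    by apply: nbhs_pinfty_ge; rewrite num_real.
  apply: filterS nC => C dC y My Gy; apply: le_trans dC.
  by rewrite (le_trans (tri p0 x y _ _ _)) // lerD2l ltW // GM.
have C1 : C < C + 1 by rewrite ltrDl.
exists ((C + 1) + (C + 1)) => q r Sq Sr.
have Mq := saturation_sub Sq; have Mr := saturation_sub Sr.
rewrite (le_trans (tri q p0 r _ _ _)) // lerD //; last exact: (HC _ C1).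
by rewrite sym //; exact: (HC _ C1).
Qed.

(** By invariance a point [p] of [A] has a preimage in [A], and the leaf of that preimage covers the
    leaf of [p] in time [tau]. The covering leaf meets [A] again, so the step can be repeated until
    the total time exceeds [t0]. *)
Lemma saturation_flow_image A : A `<=` M -> compact A ->
  (forall t, 0 <= t -> X t @` A = A) ->
  forall t0 : R, exists2 t, t0 <= t & saturation A `<=` X t @` saturation A.
Proof.
move=> AM cA invA t0; have [XM X0 X_add _] := hX.
have [tau tau0 Htau] : exists2 tau : R, 0 < tau &
    forall q, saturation A q -> leaf_liftable tau q.
  have nt : \forall tau \near (0 : R)^'+, forall q, saturation A q -> leaf_liftable tau q.
    apply: near_saturation => // x Mx; have [G [tau [oG Gx tau0 HG]]] := near_leaf_liftable Mx.
    exists G; split=> //.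
    have nt : \forall u \near (0 : R)^'+, u <= tau by exact: nbhs_right_le.
    by apply: filterS nt => u ut y My Gy; apply: leaf_liftableS ut _; exact: HG.
  have np : \forall tau \near (0 : R)^'+, 0 < tau by exact: nbhs_right_gt.
  by have [tau [? ?]] := filter_ex (filterI np nt); exists tau.
have step : saturation A `<=` X tau @` saturation A.
  move=> y [L [FL [p Ap Lp]] Ly].
  have tl : 0 <= tau by exact: ltW.
  have : (X tau @` A) p by rewrite invA.
  move=> [x Ax xp]; have [Lx FLx Lxx] := leaf_through hF (AM x Ax).
  have SLx z : Lx z -> saturation A z by move=> Lz; exists Lx => //; split=> //; exists x.
  have Lp' : L (X tau x) by rewrite xp.
  have tt : 0 <= tau <= tau by rewrite tl lexx.
  have [z Lz zy] := leaf_sub_flow_image FLx FL Lxx Lp' tt (fun z Lz => Htau z (SLx z Lz)) Ly.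
  by exists z => //; exact: SLx.
have steps j : saturation A `<=` X (j%:R * tau) @` saturation A.
  elim: j => [|j IH] y Sy.
    by exists y => //; rewrite mul0r X0 //; exact: saturation_sub Sy.
  have [z Sz <-] := step y Sy; have [w Sw <-] := IH z Sz.
  exists w => //; rewrite -natr1 mulrDl mul1r addrC X_add ?mulr_ge0 ?(ltW tau0) //.
  exact: saturation_sub Sw.
exists ((Num.truncn (`|t0| / tau)).+1%:R * tau); last exact: steps.
rewrite (le_trans (ler_norm t0)) // -ler_pdivrMr //.
by rewrite ltW // truncnS_gt.
Qed.

Lemma global_attractor_saturated (d : U -> U -> R) A : distance_on M d ->
  global_attractor M d X A -> saturated F A.
Proof.
move=> hd gA p L Ap FL Lp q Lq; have [AM cA invA _] := gA.
apply: (sub_global_attractor hd (@mf_hausdorff _ _ U) gA (@saturation_sub A)).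
- exact: saturation_bounded.
- exact: saturation_flow_image.
- by exists L => //; split=> //; exists p.
Qed.

End saturation.

Lemma C_on_continuous {R : realType} {n : nat} (U : smooth_manifold R n)
  (W : normedModType R) (f : U -> W) : C_on None setT f -> continuous f.
Proof.
move=> cf p; have dp : mdom (chart_at p) p by exact: mdom_cover.
have [h [D [oD Dp ch fh]]] := cf p (chart_at p) I dp.
have nD : \forall q \near p, h (mphi (chart_at p) q) = f q.
  have : nbhs p (mdom (chart_at p) `&` mphi (chart_at p) @^-1` D).
    by apply: open_nbhs_nbhs; split=> //; exact: open_chart_preimage.
  by apply: filterS => q [dq Dq]; rewrite fh.
have ch' : h (mphi (chart_at p) q) @[q --> p] --> h (mphi (chart_at p) p).
  exact: (cvg_comp _ _ (mphi_continuous dp) (ch 0%N _ Dp)).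
rewrite /continuous_at (_ : f p = h (mphi (chart_at p) p)); last exact: fh.
exact: cvg_trans (near_eq_cvg nD) ch'.
Qed.

Lemma closed_zero_set {R : realType} {n : nat} (U : smooth_manifold R n) (Phi : U -> R) :
  C_on None setT (Phi : U -> R^o) -> closed (zero_set Phi).
Proof.
move=> /C_on_continuous cPhi.
rewrite (_ : zero_set Phi = Phi @^-1` [set 0]) //.
by apply: closed_comp => //; exact: closed_eq.
Qed.
Theorem mainTheorem1
  (R : realType) (n : nat) (U : smooth_manifold R n)
  (* Lorentzian metric, constraint function, M = Phi^-1(0) *)
  (g : U -> tvec U -> tvec U -> R) (hg : lorentzian_metric g)
  (Phi : U -> R) (hPhi : C_on None setT (Phi : U -> R^o))
  (hdPhi : forall p, zero_set Phi p ->
     exists2 v, tangent p v & diff_on setT (Phi : U -> R^o) p v <> 0)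
  (* constant corank k >= 1, null distribution, complement S *)
  (k : nat) (hk : (1 <= k)%N)
  (hcorank : forall p, zero_set Phi p -> has_dim (null_dist g Phi p) k)
  (S : U -> set (tvec U)) (hSsmooth : smooth_subbundle (zero_set Phi) S)
  (hS : forall p, zero_set Phi p -> screen_at g Phi S p)
  (* constraint-preserving C^2 vector field and its decomposition *)
  (V : U -> tvec U) (hV : vfield_on (Some 2%N) setT V)
  (hVM : forall p, zero_set Phi p -> diff_on setT (Phi : U -> R^o) p (V p) = 0)
  (VN VS : U -> tvec U)
  (hVdec : forall p, zero_set Phi p ->
     [/\ null_dist g Phi p (VN p), S p (VS p) & V p = VN p + VS p])
  (* null foliation *)
  (hinv : involutive_dist (zero_set Phi) (null_dist g Phi))
  (F : set (set U))
  (hF : foliation_of n.-1 k (zero_set Phi) (null_dist g Phi) F)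
  (hFemb : forall L, F L -> embedded_submfd n.-1 k (zero_set Phi) L)
  (hFcpt : forall L, F L -> compact L)
  (hFhaus : leaf_space_hausdorff (zero_set Phi) F)
  (* V preserves the foliation *)
  (hVF : forall W, section_of (zero_set Phi) (null_dist g Phi) W ->
     forall p, zero_set Phi p ->
       null_dist g Phi p (lie_bracket (zero_set Phi) V W p))
  (* Lyapunov functional *)
  (Psi : U -> R) (hPsi : C_on (Some 1%N) (zero_set Phi) (Psi : U -> R^o))
  (hPsibnd : exists b : R, forall p, zero_set Phi p -> b <= Psi p)
  (hPsiN : forall p Y, zero_set Phi p -> null_dist g Phi p Y ->
     diff_on (zero_set Phi) (Psi : U -> R^o) p Y = 0)
  (c : R) (hc : 0 < c)
  (hPsiS : forall p, zero_set Phi p ->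
     diff_on (zero_set Phi) (Psi : U -> R^o) p (VS p)
       <= - c * norm_of g p (VS p) ^+ 2)
  (* intrinsic evolution *)
  (d : U -> U -> R) (hd : distance_on (zero_set Phi) d)
  (X : R -> U -> U)
  (hXsol : solution_family (zero_set Phi) V X)
  (hXflow : continuous_semiflow (zero_set Phi) X)
  (hXcpt : asymptotically_compact (zero_set Phi) d X)
  (hXabs : exists B, bounded_absorbing (zero_set Phi) d X B) :
  exists A : set U,
    [/\ global_attractor (zero_set Phi) d X A,
        forall A', global_attractor (zero_set Phi) d X A' -> A' = A,
        forall x, zero_set Phi x ->
          dist_to d (X t x) A @[t --> +oo] --> 0%E &
        saturated F A].
Proof.
have cM := closed_zero_set hPhi.
have hU := @mf_hausdorff _ _ U.
have [B hB] := hXabs.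
have gA := omega_limit_attractor hd hXflow hXcpt hB hU (@mf_second_countable _ _ U).
exists (omega_limit (zero_set Phi) d X B); split=> //.
- by move=> A'; exact: (global_attractor_unique hd hU gA).
- by move=> x; exact: (global_attractor_cvg hd hXflow gA).
- exact: (global_attractor_saturated hF hFemb hFcpt hFhaus cM hV hVF hXsol hXflow hd gA).
Qed.
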